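(* Let $N$ be a smooth manifold and consider the mechanical Lagrangian $L_{mech}(x,v)=Q_x(v)-U(x)$, $(x,v)\in TN$, where $Q$ is a positive definite $C^{2}$ quadratic form on $TN$ and $U:N\to\mathbb{R}$ is a nonnegative $C^{2}$ function. Let $\rho$ be the Riemannian metric on $N$ with $Q_x(v)=\Vert v\Vert_x^{2}/2$. Let $p\in N$ with $U(p)=0$, and suppose there are a neighborhood $V$ of $p$ in $N$ and a real valued $C^{3}$ regular function $f$ on $V$ such that $$dU(\nabla_\rho f)=O(U)$$ on $V$. Then $(p,\mathbf{0})\in TN$ is a Lyapunov unstable equilibrium point of the Lagrangian dynamics (Euler-Lagrange flow on $TN$) of $L_{mech}$.
   Context: $\nabla_\rho f$ is the gradient of $f$ with respect to $\rho$. A function is regular on $V$ if its differential is nonzero at every point of $V$. $h=O(U)$ on $V$ means there is a constant $K>0$ with $|h(x)|\le K\,U(x)$ for all $x\in V$. An equilibrium point $(p,\mathbf{0})$ is Lyapunov stable if for every neighborhood $\mathcal{O}$ of it in $TN$ there is a neighborhood $\mathcal{O}'$ of it such that every solution $(x(t),\dot x(t))$ of the Euler-Lagrange equations with $(x(0),\dot x(0))\in\mathcal{O}'$ is defined and stays in $\mathcal{O}$ for all $t\ge 0$; it is Lyapunov unstable if it is not Lyapunov stable. *)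

(* Defs.v *)
From HB Require Import structures.
From mathcomp Require Import all_boot all_order all_algebra.
From mathcomp Require Import all_classical all_reals all_analysis.
Set Implicit Arguments.
Unset Strict Implicit.
Unset Printing Implicit Defensive.
Import Order.TTheory GRing.Theory Num.Theory.
Import numFieldNormedType.Exports.
Local Open Scope classical_set_scope.
Local Open Scope ring_scope.

(* Class C^k on A, meaningful for open A only: derivatives are two-sided. *)
Fixpoint Ck (R : realType) (V W : normedModType R) (k : nat) (A : set V)
    (f : V -> W) : Prop :=
  if k is k'.+1 then
    (forall x, A x -> differentiable f x) /\ (forall v, Ck k' A ('D_v f))
  else {in A, continuous f}.

(* A chart with open domain [cdom]; the values of [cfun] outside [cdom] and of
   [cinv] outside the image are irrelevant. *)
Record chart (R : realType) (n : nat) (T : topologicalType) := Chart {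
  cdom : set T;
  cfun :> T -> 'rV[R]_n;
  cinv : 'rV[R]_n -> T;
  cdom_open : open cdom;
  cimg_open : open (cfun @` cdom);
  cfunK : {in cdom, cancel cfun cinv};
  cfun_continuous : {in cdom, continuous cfun};
  cinv_continuous : {in cfun @` cdom, continuous cinv}
}.

(* [chart_at] singles out one chart of the atlas around each point. It serves
   only to identify each tangent space with R^n, see [TN]. *)
Record smooth_manifold (R : realType) (n : nat) := SmoothManifold {
  carrier :> topologicalType;
  carrier_hausdorff : hausdorff_space carrier;
  carrier_second_countable : @second_countable carrier;
  atlas : set (chart R n carrier);
  chart_at : carrier -> chart R n carrier;
  chart_at_atlas : forall x, atlas (chart_at x);
  chart_at_dom : forall x, cdom (chart_at x) x;
  atlas_smooth : forall c c', atlas c -> atlas c' -> forall k,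
    Ck k (c @` (cdom c `&` cdom c')) (c' \o cinv c)
}.

(* The tangent vector represented by [Tangent x v] is the one whose components
   in the chart [chart_at x] are [v]. This makes T_x N the vector space R^n, but
   the topology of TN is not a product topology, as [chart_at] may jump. *)
Record TN (R : realType) (n : nat) (N : smooth_manifold R n) := Tangent {
  tbase : N;
  tvec : 'rV[R]_n
}.

Section TangentBundle.
Context (R : realType) (n : nat) (N : smooth_manifold R n).

(* The inverse of the chart of TN induced by the chart [c] of N: the vector at
   [cinv c q] whose components in [c] are [w]. *)
Definition tchart_inv (c : chart R n N) (qw : 'rV[R]_n * 'rV[R]_n) : TN N :=
  let x := cinv c qw.1 in
  Tangent x ('d (chart_at x \o cinv c) (qw.1) (qw.2)).

Definition TN_open (O : set (TN N)) : Prop :=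
  forall c, atlas c ->
    open [set qw | (c @` cdom c) qw.1 /\ O (tchart_inv c qw)].

Lemma TN_openT : TN_open setT.
Proof.
move=> c _.
have -> : [set qw | (c @` cdom c) qw.1 /\ setT (tchart_inv c qw)] =
    (@fst 'rV[R]_n 'rV[R]_n) @^-1` (c @` cdom c).
  by apply/seteqP; split => qw /= => [[]|].
by apply: open_comp; [move=> qw _; exact: cvg_fst | exact: cimg_open].
Qed.

Lemma TN_openI (A B : set (TN N)) : TN_open A -> TN_open B -> TN_open (A `&` B).
Proof.
move=> oA oB c ac.
have -> : [set qw | (c @` cdom c) qw.1 /\ (A `&` B) (tchart_inv c qw)] =
    [set qw | (c @` cdom c) qw.1 /\ A (tchart_inv c qw)] `&`
    [set qw | (c @` cdom c) qw.1 /\ B (tchart_inv c qw)].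
  apply/seteqP; split => qw /=; first by move=> [? [? ?]].
  by move=> [[? ?] [_ ?]].
exact: openI (oA c ac) (oB c ac).
Qed.

Lemma TN_open_bigU (I : Type) (A : I -> set (TN N)) :
  (forall i, TN_open (A i)) -> TN_open (\bigcup_i A i).
Proof.
move=> oA c ac.
have -> : [set qw | (c @` cdom c) qw.1 /\ (\bigcup_i A i) (tchart_inv c qw)] =
    \bigcup_i [set qw | (c @` cdom c) qw.1 /\ A i (tchart_inv c qw)].
  apply/seteqP; split => qw /=; first by move=> [? [i _ ?]]; exists i.
  by move=> [i _ [? ?]]; split => //; exists i.
by apply: bigcup_open => i _; exact: oA.
Qed.

HB.instance Definition _ := gen_eqMixin (TN N).
HB.instance Definition _ := gen_choiceMixin (TN N).
HB.instance Definition _ :=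
  isOpenTopological.Build (TN N) TN_openT TN_openI TN_open_bigU.

Definition Ck_on (k : nat) (V : set N) (f : N -> R) : Prop :=
  forall c, atlas c -> Ck k (c @` (cdom c `&` V)) (f \o cinv c).

Definition Ck_TN (k : nat) (F : TN N -> R) : Prop :=
  forall c, atlas c -> Ck k ((c @` cdom c) `*` setT) (F \o tchart_inv c).

Definition dmfd (f : N -> R) (x : N) : 'rV[R]_n -> R :=
  'd (f \o cinv (chart_at x)) (chart_at x x).

Definition regular_on (V : set N) (f : N -> R) : Prop :=
  forall x, V x -> exists v, dmfd f x v != 0.

Definition quadratic_form (q : 'rV[R]_n -> R) : Prop :=
  exists B : {symmetric 'rV[R]_n}, forall v, q v = B v v.

Definition posdef (q : 'rV[R]_n -> R) : Prop :=
  forall v, v != 0 -> 0 < q v.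

Definition grad (rho : forall x : N, {dot 'rV[R]_n for idfun}) (f : N -> R)
    (x : N) : 'rV[R]_n :=
  xget 0 [set g | forall v, rho x g v = dmfd f x v].

Definition bigO_on (V : set N) (h U : N -> R) : Prop :=
  exists2 K : R, 0 < K & forall x, V x -> `|h x| <= K * U x.

Definition Lmech (Q : TN N -> R) (U : N -> R) : TN N -> R :=
  fun z => Q z - U (tbase z).

(* The velocity of the curve [x] at time [t]. *)
Definition lift (x : R -> N) (t : R) : TN N :=
  Tangent (x t) (derive1 (chart_at (x t) \o x) t).

(* d/dt (dL/dv^k) = dL/dq^k in every chart, on the open interval (a, b).
   For the mechanical Lagrangians these equations give x'' as a continuous
   function of (x, x'), so that solutions are of class C^2. *)
Definition EL_solution (L : TN N -> R) (a b : \bar R) (x : R -> N) : Prop :=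
  (a < 0%:E < b)%E /\
  forall t : R, (a < t%:E < b)%E ->
    {for t, continuous x} /\
    forall c, atlas c -> cdom c (x t) ->
      let q := c \o x in
      let Lc := L \o tchart_inv c in
      [/\ derivable q t 1, derivable (derive1 q) t 1 &
          forall k : 'I_n,
            is_derive t 1
              (fun s => 'D_((0 : 'rV[R]_n), (delta_mx 0 k : 'rV[R]_n)) Lc
                          (q s, derive1 q s))
              ('D_((delta_mx 0 k : 'rV[R]_n), (0 : 'rV[R]_n)) Lc
                 (q t, derive1 q t))].

Definition maximal_EL_solution (L : TN N -> R) (a b : \bar R) (x : R -> N) :
    Prop :=
  EL_solution L a b x /\
  forall a' b' y, EL_solution L a' b' y -> (a' <= a)%E -> (b <= b')%E ->
    (forall t : R, (a < t%:E < b)%E -> y t = x t) -> a' = a /\ b' = b.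

Definition equilibrium (L : TN N -> R) (z : TN N) : Prop :=
  exists2 x, EL_solution L -oo%E +oo%E x & forall t, lift x t = z.

Definition lyapunov_stable (L : TN N -> R) (z : TN N) : Prop :=
  forall O, nbhs z O -> exists2 O', nbhs z O' &
    forall a b x, maximal_EL_solution L a b x -> O' (lift x 0) ->
      b = +oo%E /\ forall t, 0 <= t -> O (lift x t).

End TangentBundle.

(* Main.v *)
Require Import Defs.
From HB Require Import structures.
From mathcomp Require Import all_boot all_order all_algebra.
From mathcomp Require Import all_classical all_reals all_analysis.
From mathcomp Require Import ring lra.
Import Order.TTheory GRing.Theory Num.Theory.
Import numFieldNormedType.Exports.
Local Open Scope classical_set_scope.
Local Open Scope ring_scope.

(** Along a motion [x] the second derivative of [f (x t)] is a quadratic form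
    in the velocity minus [dU (grad f)], hence is at most [C * E] in absolute
    value near [p], where [E] is the conserved energy. Start at [p], where [U]
    vanishes, with velocity [e * grad f]: then [E = e^2 m / 2], and
    [f (x t)] has initial derivative [e m], with [m = |grad f|^2] at [p].
    So the derivative stays above [e m / 2] up to time [1 / (C e)], and by then
    [f] has grown by [m / (2 C)], whatever [e] is: a motion confined to a
    neighbourhood of [p] on which [f] varies less cannot last that long.

    Such motions exist by the Picard-Lindeloef theorem, applied in a chart to the
    position and the momentum, and extend to maximal ones by Zorn's lemma. *)

Set Implicit Arguments.
Unset Strict Implicit.
Unset Printing Implicit Defensive.

(** * The Picard-Lindeloef theorem *)

(** Regularity shapes the existence part. [Q] and [U] are C^2, so the forces, which contain first
    derivatives of the metric and of the potential, are C^1. The momentum depends linearly on the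
    velocity, hence position and momentum obey a first-order system with a locally Lipschitz
    right-hand side, although the equations are of second order. The bound by [C * E] has two
    sources. The terms quadratic in the velocity are dominated by the kinetic energy, because the
    metric stays uniformly coercive near [p]; the term [dU (grad f)] is dominated by the potential
    energy, which is the hypothesis on [f]. Each half of the energy pays for one of them, so no
    separate control of speed or height is required. Stability is a statement about all maximal
    solutions, hence it is refuted only by an actual one. The escape argument lives in a single
    chart, but a solution has to satisfy the equations in every chart of the atlas; this is why the
    invariance of the equations under coordinate changes has to be proved. *)

Section Picard.
Context {R : realType}.

Lemma mx_norm_le m n (A : 'M[R]_(m, n)) e :
  0 <= e -> (forall i j, `|A i j| <= e) -> `|A| <= e.
Proof.
move=> e0 Ae; rewrite [leLHS]/Num.Def.normr/= mx_normrE.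
by rewrite bigmax_le// => -[i j] _; exact: Ae.
Qed.

Lemma mx_entry_le m n (A : 'M[R]_(m, n)) i j : `|A i j| <= `|A|.
Proof.
by rewrite [leRHS]/Num.Def.normr/= mx_normrE; exact: (le_bigmax _ _ (i, j)).
Qed.

Lemma MVT_dist (f df : R -> R) (M s t : R) : s <= t ->
  (forall x, s <= x <= t -> is_derive x 1 f (df x)) ->
  (forall x, s <= x <= t -> `|df x| <= M) -> `|f t - f s| <= M * (t - s).
Proof.
move=> st fdf dfM.
have [||c cst ->] := @MVT_segment _ f df s t st.
- by move=> x xst; apply: fdf; rewrite !ltW ?(itvP xst).
- apply: derivable_within_continuous => x xst.
  by apply: (@ex_derive _ _ _ _ _ _ (df x)); apply: fdf; rewrite !(itvP xst).
rewrite normrM (ger0_norm (_ : 0 <= t - s)) ?subr_ge0//.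
by rewrite ler_wpM2r ?subr_ge0// dfM// !(itvP cst).
Qed.

Definition clamp (a b x : R) : R := if x < a then a else if b < x then b else x.

Lemma clamp_itv a b x : a <= b -> a <= clamp a b x <= b.
Proof.
move=> ab; rewrite /clamp; case: (ltP x a) => xa; first by rewrite lexx ab.
by case: (ltP b x) => xb; [rewrite ab lexx|rewrite xa xb].
Qed.

Lemma clamp_id a b x : a <= x <= b -> clamp a b x = x.
Proof. by rewrite /clamp => /andP[]; case: (ltP x a) => //; case: (ltP b x). Qed.

Lemma clamp_lip a b x y : a <= b -> `|clamp a b x - clamp a b y| <= `|x - y|.
Proof.
move=> ab; have /ler_normlP := lexx `|x - y|; rewrite opprB ler_norml /clamp.
by case: (ltP x a) => ?; case: (ltP y a) => ?; case: (ltP b x) => ?;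
  case: (ltP b y) => ? [? ?]; apply/andP; split; lra.
Qed.

Lemma near_dist (V : normedModType R) (x : V) e : 0 < e ->
  \forall y \near x, `|x - y| < e.
Proof. by move=> e0; apply/nbhs_normP; exists e. Qed.

Lemma nbhs_dist (V : normedModType R) (x : V) (P : set V) : nbhs x P ->
  exists2 e, 0 < e & forall y, `|x - y| < e -> P y.
Proof. by move/nbhs_normP => [e e0 eP]; exists e => // y xy; exact: eP. Qed.

Lemma lipschitz_continuous (V W : normedModType R) (h : V -> W) B :
  (forall s t, `|h s - h t| <= B * `|s - t|) -> continuous h.
Proof.
move=> hB t; apply/cvgrPdist_le => e e0.
have [B0|B0] := lerP B 0.
  apply: nearW => s; apply: (le_trans (hB _ _)).
  by rewrite (le_trans _ (ltW e0))// mulr_le0_ge0.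
near=> s; apply: (le_trans (hB _ _)).
rewrite mulrC -ler_pdivlMr// ltW//.
near: s; exact: near_dist (divr_gt0 e0 B0).
Unshelve. all: by end_near. Qed.

Lemma antiderivative (d : R) (h : R -> R) : 0 < d -> continuous h ->
  exists H : R -> R, H 0 = 0 /\ (forall t : R, `|t| <= d -> is_derive t 1 H (h t)).
Proof.
move=> d0 ch.
(* The base point lies strictly to the left of [- d], so that every [t] with [|t| <= d] is interior
   and the derivative is two-sided. *)
pose F (y : R) : R := (\int[lebesgue_measure]_(t in [set` `[(- d - 1)%R, y]]) (h t))%R.
exists (fun y => F y - F 0); split; first by rewrite subrr.
move=> t; rewrite ler_norml => /andP[td td'].
have [|||dF F'] := @continuous_FTC1_closed R h (- d - 1) t (d + 1) _ _ _ (ch t).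
- by lra.
- apply: continuous_compact_integrable; first exact: segment_compact.
  exact: continuous_subspaceT.
- by lra.
have HF : is_derive t 1 F (h t) by rewrite -F' derive1E; exact: derivableP.
by rewrite -[h t]subr0; apply: is_deriveB.
Qed.

(** Clamping the time makes the antiderivative constant outside [[- d, d]]. Both bounds then hold at
    all real times, and only the derivative is confined to [|t| < d]. They come from the same mean
    value estimate [key], applied to [h] and to [h - h']. *)
Lemma antiderivative_op (d : R) : 0 < d ->
  exists I : (R -> R) -> R -> R,
    [/\ forall h, continuous h -> I h 0 = 0,
        forall h, continuous h -> forall t : R, `|t| < d -> is_derive t 1 (I h) (h t),
        forall h B, continuous h -> (forall t, `|h t| <= B) ->
          forall s t, `|I h t - I h s| <= B * `|t - s| &
        forall h h' B, continuous h -> continuous h' ->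
          (forall t, `|h t - h' t| <= B) -> forall t, `|I h t - I h' t| <= d * B].
Proof.
move=> d0.
have /choice[I0 I0P] : forall h : R -> R, exists H, continuous h ->
    H 0 = 0 /\ (forall t : R, `|t| <= d -> is_derive t 1 H (h t)).
  move=> h; have [ch|nch] := pselect (continuous h); last by exists h.
  by have [H HP] := antiderivative d0 ch; exists H.
have ndd : - d <= d by lra.
pose c := clamp (- d) d.
have cd t : `|c t| <= d by rewrite ler_norml clamp_itv.
have c0 : c 0 = 0 by apply: clamp_id; lra.
have key (H k : R -> R) B : (forall t : R, `|t| <= d -> is_derive t 1 H (k t)) ->
    (forall t, `|k t| <= B) -> forall s t, `|s| <= d -> `|t| <= d ->
    `|H t - H s| <= B * `|t - s|.
  move=> HD kB s t sd td; wlog st : s t sd td / s <= t.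
    move=> W; have [st|/ltW ts] := leP s t; first exact: W.
    by rewrite distrC (distrC t); exact: W.
  rewrite (ger0_norm (_ : 0 <= t - s)) ?subr_ge0//.
  apply: (@MVT_dist H k) => // x /andP[sx xt]; apply: HD.
  by move: sd td; rewrite !ler_norml => /andP[? _] /andP[_ ?]; apply/andP; split; lra.
exists (fun h t => I0 h (c t)); split.
- by move=> h /I0P[H0 _]; rewrite c0.
- move=> h /I0P[_ HD] t td; apply: near_eq_is_derive (HD t (ltW td)).
  have := td; rewrite ltr_norml => /andP[dt td'].
  near=> s; rewrite /c clamp_id//; apply/andP; split; apply: ltW; near: s.
    exact: lt_nbhsr.
  exact: lt_nbhsl.
- move=> h B ch hB s t; have [_ HD] := I0P h ch.
  apply: (le_trans (key _ _ B HD hB _ _ (cd s) (cd t))).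
  by rewrite ler_wpM2l// ?clamp_lip// (le_trans _ (hB 0)).
- move=> h h' B ch ch' hB t; have [H0 HD] := I0P h ch; have [H0' HD'] := I0P h' ch'.
  have B0 : 0 <= B by rewrite (le_trans _ (hB 0)).
  have HHD (x : R) : `|x| <= d -> is_derive x 1 (I0 h \- I0 h') (h x - h' x).
    by move=> xd; have := HD x xd; have := HD' x xd => ? ?; exact: is_deriveB.
  have := key _ _ B HHD hB 0 (c t).
  rewrite normr0 => /(_ (ltW d0) (cd t)) /=; rewrite H0 H0' !subr0.
  by move/le_trans; apply; rewrite mulrC ler_wpM2r.
Unshelve. all: by end_near. Qed.

Lemma geometric_cvg (u : nat -> R) (c : R) :
  (forall k, `|u k.+1 - u k| <= c / 2 ^+ k) ->
  exists l, forall k, `|u k - l| <= 2 * c / 2 ^+ k.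
Proof.
move=> uc.
(* The tail of the geometric series: the sum of [c / 2 ^+ j] over [j >= k]. *)
pose e k : R := 2 * c / 2 ^+ k.
have eS k : e k.+1 = e k - c / 2 ^+ k.
  by rewrite /e exprS invfM; field; rewrite expf_neq0.
have c0 : 0 <= c by have := uc 0%N; rewrite expr0 divr1; exact: le_trans.
have e0 k : 0 <= e k by rewrite /e !mulr_ge0// invr_ge0 exprn_ge0.
have dec j k : u (k + j)%N + e (k + j)%N <= u k + e k.
  elim: j => [|j]; first by rewrite addn0.
  apply: le_trans; rewrite addnS eS; have := uc (k + j)%N.
  by rewrite ler_norml => /andP[_ ?]; lra.
have inc j k : u k - e k <= u (k + j)%N - e (k + j)%N.
  elim: j => [|j]; first by rewrite addn0.
  move/le_trans; apply; rewrite addnS eS; have := uc (k + j)%N.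
  by rewrite ler_norml => /andP[? _]; lra.
have cross j k : u j - e j <= u k + e k.
  have [jk|/ltnW kj] := leqP j k.
    have := inc (k - j)%N j; rewrite subnKC// => /le_trans; apply.
    by have := e0 k; lra.
  have := dec (j - k)%N k; rewrite subnKC//; apply: le_trans.
  by have := e0 j; lra.
(* [u - e] increases, [u + e] decreases, and [e] tends to 0. *)
pose S := range (fun k => u k - e k).
have supS : has_sup S.
  split; first by exists (u 0%N - e 0%N); exists 0%N.
  by exists (u 0%N + e 0%N) => _ [j _ <-].
exists (sup S) => k.
have lo : u k - e k <= sup S by apply: sup_upper_bound => //; exists k.
have hi : sup S <= u k + e k by apply: ge_sup; [case: supS|move=> _ [j _ <-]].
by rewrite ler_norml; apply/andP; split; rewrite -/(e k); lra.
Qed.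

(** Picard iteration: integration against [G] contracts by 1/2, so the iterates converge
    geometrically at each time. They share the Lipschitz constant [M], which the limit inherits;
    this makes the limit continuous and lets it be integrated in turn. *)
Lemma picard m n (g : 'M[R]_(m, n) -> 'M[R]_(m, n)) z0 (K r : R) : 0 < r ->
  (forall y y', `|y - z0| <= r -> `|y' - z0| <= r -> `|g y - g y'| <= K * `|y - y'|) ->
  exists2 d, 0 < d & exists z : R -> 'M[R]_(m, n),
    z 0 = z0 /\ forall t : R, `|t| < d -> is_derive t 1 z (g (z t)).
Proof.
move=> r0 gK.
(* [g \o cl] is bounded and globally Lipschitz, and coincides with [g] where the
   solution lives. *)
pose cl (y : 'M[R]_(m, n)) := \matrix_(i, j) clamp (z0 i j - r) (z0 i j + r) (y i j).
have clr y : `|cl y - z0| <= r.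
  apply: mx_norm_le => [|i j]; first exact: ltW.
  rewrite !mxE ler_distl; apply: clamp_itv; lra.
have cl_lip y y' : `|cl y - cl y'| <= `|y - y'|.
  apply: mx_norm_le => // i j; rewrite !mxE (le_trans (clamp_lip _ _ _))//; first lra.
  by have := mx_entry_le (y - y') i j; rewrite !mxE.
have cl_id y : `|y - z0| <= r -> cl y = y.
  move=> yr; apply/matrixP => i j; rewrite mxE clamp_id//.
  by rewrite -ler_distl; have := mx_entry_le (y - z0) i j; rewrite !mxE => /le_trans; apply.
pose k0 := `|K| + 1; have k00 : 0 < k0 by rewrite ltr_wpDl.
pose G := g \o cl.
have GK y y' : `|G y - G y'| <= k0 * `|y - y'|.
  apply: (le_trans (gK _ _ (clr y) (clr y'))).
  apply: (@le_trans _ _ (k0 * `|cl y - cl y'|)); last by rewrite ler_wpM2l// ltW.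
  by rewrite ler_wpM2r// /k0; have := ler_norm K; lra.
pose M := `|g z0| + k0 * r + 1.
have M0 : 0 < M by rewrite /M !ltr_wpDl// addr_ge0// mulr_ge0// ltW.
have GM y : `|G y| <= M.
  have -> : G y = G z0 + (G (cl y) - G z0).
    rewrite addrC subrK /G /=; congr g; rewrite [RHS]cl_id//.
  have Gz0 : G z0 = g z0 by rewrite /G /= cl_id// subrr normr0 ltW.
  rewrite (le_trans (ler_normD _ _))// Gz0 /M -addrA lerD2l -Gz0.
  rewrite (le_trans (GK _ _))// ler_wpDr// ler_wpM2l//; exact: ltW.
(* [r / M] keeps a curve of speed at most [M] within [r] of [z0]; [(2 * k0)^-1] makes the
   contraction factor 1/2. *)
pose d := Num.min (r / M) (2 * k0)^-1.
have d0 : 0 < d by rewrite lt_min divr_gt0// invr_gt0 mulr_gt0.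
have dr : M * d <= r by rewrite mulrC -ler_pdivlMr// ge_min lexx.
have dk : d * k0 <= 2^-1.
  by rewrite -ler_pdivlMr// -invfM ge_min lexx orbT.
have [I0 [I00 I0D I0lip I0dist]] := antiderivative_op d0.
pose I (h : R -> 'M[R]_(m, n)) t := z0 + \matrix_(i, j) I0 (fun s => h s i j) t.
have centry h i j : continuous h -> continuous (fun s : R => (h s : 'M[R]_(m, n)) i j).
  by move=> ch t; apply: (@continuous_comp _ _ _ h (fun A : 'M[R]_(m, n) => A i j) t (ch t));
    exact: coord_continuous.
have cG h : continuous h -> continuous (G \o h).
  have cGG : continuous G by exact: lipschitz_continuous GK.
  by move=> ch t; exact: (cvg_comp _ _ (ch t) (cGG (h t))).
have IM h s t : continuous h -> (forall t, `|h t| <= M) -> `|I h s - I h t| <= M * `|s - t|.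
  move=> ch hM; apply: mx_norm_le => [|i j]; first by rewrite mulr_ge0// ltW.
  rewrite !mxE opprD addrACA subrr add0r; apply: I0lip; first exact: centry.
  by move=> x; rewrite (le_trans (mx_entry_le _ _ _)).
have Id h h' B t : continuous h -> continuous h' -> (forall t, `|h t - h' t| <= B) ->
    `|I h t - I h' t| <= d * B.
  move=> ch ch' hB.
  have B0 : 0 <= B by rewrite (le_trans _ (hB 0)).
  apply: mx_norm_le => [|i j]; first by rewrite mulr_ge0// ltW.
  rewrite !mxE opprD addrACA subrr add0r; apply: I0dist; [exact: centry..|].
  by move=> x; rewrite (le_trans _ (hB x))//; have := mx_entry_le (h x - h' x) i j; rewrite !mxE.
pose z := fix z k := if k is k'.+1 then I (G \o z k') else cst z0.
have zlip k s t : `|z k s - z k t| <= M * `|s - t| /\ continuous (z k).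
  elim: k s t => [|k IH] s t.
    split; last exact: cst_continuous.
    by rewrite /= subrr normr0 mulr_ge0// ltW.
  have [_ ck] := IH 0 0.
  have L s' t' : `|z k.+1 s' - z k.+1 t'| <= M * `|s' - t'|.
    by apply: IM => [|x]; [exact: cG|exact: GM].
  by split=> //; exact: lipschitz_continuous L.
have cz k : continuous (z k) by have [] := zlip k 0 0.
have I_0 h : continuous h -> I h 0 = z0.
  move=> ch; apply/matrixP => i j; rewrite !mxE I00 ?addr0//; exact: centry.
have z_0 k : z k 0 = z0 by case: k => [//|k]; apply: I_0; exact: cG.
have zS k t : `|z k.+1 t - z k t| <= (d * M) / 2 ^+ k.
  elim: k t => [|k IH] t.
    rewrite expr0 divr1.
    have c0 : continuous (cst 0 : R -> 'M[R]_(m, n)) by move=> x; exact: cst_continuous.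
    (* As the integral of the zero function, the constant iterate can be compared with the next one
       by [Id], just like the later ones. *)
    have -> : z 0%N t = I (cst 0) t.
      apply/matrixP => i j; rewrite !mxE.
      have cc : continuous (fun s : R => (cst 0 s : 'M[R]_(m, n)) i j) by exact: centry.
      have := I0lip _ 0 cc _ 0 t; rewrite mul0r I00// subr0 normr_le0 => H.
      rewrite (eqP (H _)) ?addr0// => x.
      by rewrite /cst mxE normr0.
    by apply: Id => [||x]; [exact: cG _ _ (cz 0%N)|exact: c0|rewrite subr0; exact: GM].
  have H : `|I (G \o z k.+1) t - I (G \o z k) t| <= d * (k0 * (d * M / 2 ^+ k)).
    apply: Id => [||s]; [exact: cG _ _ (cz k.+1)|exact: cG _ _ (cz k)|].
    by rewrite (le_trans (GK _ _))// ler_wpM2l// ltW.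
  apply: (le_trans H).
  have -> : d * M / 2 ^+ k.+1 = 2^-1 * (d * M / 2 ^+ k) by rewrite exprS invfM mulrCA.
  rewrite mulrA ler_wpM2r//.
  by rewrite mulr_ge0 ?invr_ge0 ?exprn_ge0// mulr_ge0// ltW.
have lim t : exists l : 'M[R]_(m, n), forall k, `|z k t - l| <= 2 * (d * M) / 2 ^+ k.
  have H i j : exists l, forall k, `|z k t i j - l| <= 2 * (d * M) / 2 ^+ k.
    apply: geometric_cvg => k; apply: le_trans (zS k t).
    by have := mx_entry_le (z k.+1 t - z k t) i j; rewrite !mxE.
  have /choice[l lP] : forall i, exists li : 'I_n -> R, forall j k,
      `|z k t i j - li j| <= 2 * (d * M) / 2 ^+ k.
    by move=> i; have [li liP] := choice (H i); exists li.
  exists (\matrix_(i, j) l i j) => k; apply: mx_norm_le => [|i j].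
    by rewrite !mulr_ge0// ?invr_ge0 ?exprn_ge0// ltW.
  by rewrite !mxE.
have [w wP] := choice lim.
have small (c x : R) : (forall k, x <= c / 2 ^+ k) -> x <= 0.
  move=> xc; apply/ler_addgt0Pr => e e0; rewrite add0r.
  have [c0|c0] := lerP c 0.
    by rewrite (le_trans (xc 0%N))// expr0 divr1 (le_trans c0)// ltW.
  have [k kP] : exists k : nat, c / e < 2 ^+ k.
    pose N := Num.bound (c / e); exists N.
    apply: (lt_le_trans (archi_boundP _)); first by rewrite divr_ge0 ?ltW.
    by rewrite -natrX ler_nat ltnW// ltn_expl.
  rewrite (le_trans (xc k))// ler_pdivrMr ?exprn_gt0//.
  by rewrite mulrC -ler_pdivrMr// ltW.
have wlip s t : `|w s - w t| <= M * `|s - t|.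
  rewrite -subr_le0; apply: (small (4 * (d * M))) => k.
  have [+ _] := zlip k s t; have := wP s k; have := wP t k; rewrite (distrC _ (w s)).
  have -> : w s - w t = (w s - z k s) + (z k s - z k t) + (z k t - w t).
    by rewrite !subrKA.
  move=> h1 h2 h3; rewrite lerBlDr.
  apply: (le_trans (ler_normD _ _)); have := ler_normD (w s - z k s) (z k s - z k t).
  move: h1 h2; have -> : 4 * (d * M) / 2 ^+ k = 2 * (2 * (d * M) / 2 ^+ k).
    by rewrite !mulrA -natrM.
  by lra.
have cw := lipschitz_continuous wlip.
have wI t : w t = I (G \o w) t.
  apply/eqP; rewrite -subr_eq0 -normr_le0; apply: (small (2 * (d * M))) => k.
  have := wP t k.+1; rewrite distrC => h1.
  have h2 : `|z k.+1 t - I (G \o w) t| <= d * (k0 * (2 * (d * M) / 2 ^+ k)).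
    apply: Id => [||s]; [exact: cG|exact: cG|].
    by rewrite (le_trans (GK _ _))// ler_wpM2l// ltW.
  rewrite -(subrKA (z k.+1 t)) (le_trans (ler_normD _ _))//.
  have E0 : 0 <= 2 * (d * M) / 2 ^+ k.
    by rewrite !mulr_ge0// ?invr_ge0 ?exprn_ge0// ltW.
  have h3 : d * (k0 * (2 * (d * M) / 2 ^+ k)) <= 2^-1 * (2 * (d * M) / 2 ^+ k).
    by rewrite (mulrA d k0) ler_wpM2r.
  move: h1; have -> : 2 * (d * M) / 2 ^+ k.+1 = 2^-1 * (2 * (d * M) / 2 ^+ k).
    by rewrite exprS invfM mulrCA.
  by lra.
have w0 : w 0 = z0 by rewrite wI I_0//; exact: cG.
exists d => //; exists w; split=> // t td.
(* Up to time [d] the solution stays where clamping is the identity, so it solves the original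
   equation. *)
have <- : G (w t) = g (w t).
  rewrite /G /= cl_id// -w0 (le_trans (wlip t 0))// subr0.
  by apply: le_trans dr; rewrite ler_wpM2l ?ltW.
have Dij i j : is_derive t 1 (fun s : R => w s i j) (G (w t) i j).
  have -> : (fun s => w s i j) = (fun s => z0 i j + I0 (fun s => (G \o w) s i j) s).
    by apply/funext => s; rewrite {1}wI !mxE.
  have D := I0D _ (centry _ i j (cG _ _ cw)) t td.
  by rewrite -[X in is_derive _ _ _ X]add0r; exact: is_deriveD.
have Dw : derivable w t 1.
  by apply/derivable_mxP => i j; exact: (@ex_derive _ _ _ _ _ _ _ (Dij i j)).
apply: DeriveDef => //; rewrite derive_mx//; apply/matrixP => i j; rewrite mxE.
exact: derive_val.
Unshelve. all: by end_near. Qed.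
End Picard.

(** * Differential calculus along curves and lines *)

Section Calculus.
Context {R : realType}.

Lemma is_derive_curve (V W : normedModType R) (F : V -> W) (q : R -> V) (t : R) dq :
  differentiable F (q t) -> is_derive t 1 q dq ->
  is_derive t 1 (F \o q) ('D_dq F (q t)).
Proof.
move=> dF [/derivable1_diffP dqt <-].
have dFq : differentiable (F \o q) t by exact: differentiable_comp.
apply: DeriveDef; first exact/derivable1_diffP.
by rewrite deriveE// diff_comp//= -deriveE// -deriveE.
Qed.

Lemma derive_line (V W : normedModType R) (f : V -> W) x v :
  'D_v f x = 'D_1 (fun h : R => f (h *: v + x)) 0.
Proof.
rewrite /derive; set a := (X in lim (X @ _)); set b := (X in _ = lim (X @ _)).
suff -> : a = b by [].
by apply/funext => h; rewrite /a /b /= [h *: 1]mulr1 addr0 scale0r add0r.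
Qed.

Lemma is_derive_line (V W : normedModType R) (f : V -> W) x v d :
  is_derive (0 : R) 1 (fun h : R => f (h *: v + x)) d -> is_derive x v f d.
Proof.
move=> [df <-]; apply: DeriveDef; first exact/derivable1P.
exact: derive_line.
Qed.

Lemma is_derive_affine (V : normedModType R) (x v : V) (t : R) :
  is_derive t 1 (fun h : R => h *: v + x) v.
Proof.
rewrite -[X in is_derive _ _ _ X]addr0; apply: is_deriveD.
have d : differentiable (fun h : R => h *: v) t by exact: differentiableZl.
apply: DeriveDef; first exact: diff_derivable.
by rewrite deriveE// (_ : (fun h : R => h *: v) = ( *:%R^~ v))// diff_val scale1r.
Qed.

Lemma is_derive_along (V W : normedModType R) (f : V -> W) x v (t : R) :
  differentiable f (t *: v + x) ->
  is_derive t 1 (fun h : R => f (h *: v + x)) ('D_v f (t *: v + x)).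
Proof.
by move=> df; apply: (is_derive_curve (q := fun h : R => h *: v + x)) => //;
  exact: is_derive_affine.
Qed.

Lemma is_derive_entry (V : normedModType R) m n (M : V -> 'M[R]_(m, n)) x v (D : 'M[R]_(m, n)) i j :
  is_derive x v M D -> is_derive x v (fun y => M y i j) (D i j).
Proof.
move=> [dM <-]; apply: DeriveDef; first exact: (derivable_mxP _ _ _).1.
by rewrite derive_mx// mxE.
Qed.

Lemma is_derive_mx (V : normedModType R) m n (M : V -> 'M[R]_(m, n)) x v (D : 'M[R]_(m, n)) :
  (forall i j, is_derive x v (fun y => M y i j) (D i j)) -> is_derive x v M D.
Proof.
move=> DM; have dM : derivable M x v by apply/derivable_mxP => i j; have [] := DM i j.
apply: DeriveDef => //; rewrite derive_mx//; apply/matrixP => i j; rewrite mxE.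
by have [_ ->] := DM i j.
Qed.

Lemma derive_entry (V : normedModType R) m n (M : V -> 'M[R]_(m, n)) x v i j :
  differentiable M x -> ('D_v M x) i j = 'D_v (fun y => M y i j) x.
Proof. by move=> dM; rewrite derive_mx ?mxE//; exact: diff_derivable. Qed.

Lemma rV_basis n (v : 'rV[R]_n) : v = \sum_i v 0 i *: delta_mx 0 i.
Proof. exact: row_sum_delta. Qed.

Lemma derive_basis (W : normedModType R) n (F : 'rV[R]_n -> W) x v :
  differentiable F x -> 'D_v F x = \sum_i v 0 i *: 'D_(delta_mx 0 i) F x.
Proof.
move=> dF; rewrite deriveE// {1}(rV_basis v) linear_sum/=.
by apply: eq_bigr => i _; rewrite linearZ/= deriveE.
Qed.

Lemma deriveZv (V W : normedModType R) (F : V -> W) x v (a : R) :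
  differentiable F x -> 'D_(a *: v) F x = a *: 'D_v F x.
Proof. by move=> dF; rewrite !deriveE// linearZ. Qed.

Lemma deriveDv (V W : normedModType R) (F : V -> W) x u v :
  differentiable F x -> 'D_(u + v) F x = 'D_u F x + 'D_v F x.
Proof. by move=> dF; rewrite !deriveE// linearD. Qed.

Lemma near_in (T : topologicalType) (A : set T) x : open A -> A x -> \forall y \near x, A y.
Proof. by move=> oA Ax; exact: open_nbhs_nbhs. Qed.

(** The differential of [f] also serves for [g]: the first-order expansion at [x] sees only values
    near [x]. *)
Lemma near_eq_differentiable (V W : normedModType R) (f g : V -> W) x :
  (\near x, f x = g x) -> differentiable f x -> differentiable g x.
Proof.
move=> fg df.
have cdf := diff_continuous df.
have E : g \o shift x = cst (g x) + 'd f x +o_ (0 : V) id.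
  apply/eqaddoP => e e0; have /eqaddoP/(_ e e0) := diff_locally df.
  rewrite -(nbhs_singleton fg).
  move: fg; rewrite (near_shift 0) subr0 => fg0 H; near=> h.
  have -> : (g \o shift x - (cst (f x) + 'd f x)) h =
            (f \o shift x - (cst (f x) + 'd f x)) h.
    have E1 : f (h + x) = g (h + x) by near: h.
    by rewrite -![(_ - _ : _ -> _) _]/(_ - _) /= E1.
  by near: h.
have dg := diff_unique cdf E.
by apply/diff_locallyP; rewrite dg.
Unshelve. all: by end_near. Qed.

(** Differentiation rules give identities of derivatives at the points of [A] only; openness of [A]
    lets such identities be used under further derivatives. *)
Lemma Ck_eq (V W : normedModType R) k (A : set V) (f g : V -> W) : open A ->
  (forall x, A x -> f x = g x) -> Ck k A f -> Ck k A g.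
Proof.
move=> oA; elim: k f g => [|k IH] f g fg /=.
  move=> cf x /set_mem Ax; have := cf x (mem_set Ax).
  rewrite /continuous_at -fg//; apply: cvg_trans; apply: near_eq_cvg.
  by apply: filterS (near_in oA Ax) => y /fg.
move=> [df Df]; split=> [x Ax|v].
  by apply: near_eq_differentiable (df x Ax); apply: filterS (near_in oA Ax) => y /fg.
apply: IH (Df v) => x Ax; apply: near_eq_derive.
by apply: filterS (near_in oA Ax) => y /fg.
Qed.

Lemma Ck_sub (V W : normedModType R) k (A B : set V) (f : V -> W) :
  B `<=` A -> Ck k A f -> Ck k B f.
Proof.
move=> BA; elim: k f => [|k IH] f /=.
  by move=> cf x /set_mem Bx; apply: cf; apply: mem_set; exact: BA.
by move=> [df Df]; split=> [x /BA|v]; [exact: df|exact: IH].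
Qed.

Lemma CkS (V W : normedModType R) k (A : set V) (f : V -> W) : Ck k.+1 A f -> Ck k A f.
Proof.
elim: k f => [|k IH] f [df Df] /=.
  by move=> x /set_mem Ax; apply: differentiable_continuous; exact: df.
by split=> // v; exact: IH.
Qed.

Lemma CkB (V W : normedModType R) k (A : set V) (f g : V -> W) : open A ->
  Ck k A f -> Ck k A g -> Ck k A (f - g).
Proof.
move=> oA; elim: k f g => [|k IH] f g /=.
  by move=> cf cg x Ax; apply: continuousB; [exact: cf|exact: cg].
move=> [df Df] [dg Dg]; split=> [x Ax|v].
  by apply: differentiableB; [exact: df|exact: dg].
apply: Ck_eq (IH _ _ (Df v) (Dg v)) => // x Ax.
by rewrite /= deriveB//; apply: diff_derivable; [exact: df|exact: dg].
Qed.

Lemma Ck_entry (V : normedModType R) m n k (A : set V) (f : V -> 'M[R]_(m, n)) i j :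
  open A -> Ck k A f -> Ck k A (fun x => f x i j).
Proof.
move=> oA; elim: k f => [|k IH] f /=.
  by move=> cf x Ax; exact: (cvg_comp _ _ (cf x Ax) (@coord_continuous _ _ _ i j (f x))).
move=> [df Df]; split=> [x Ax|v].
  apply: (@differentiable_comp _ _ _ _ f (fun M : 'M[R]_(m, n) => M i j)); first exact: df.
  exact: differentiable_coord.
apply: Ck_eq (IH _ (Df v)) => // x Ax.
by rewrite derive_mx ?mxE//; apply: diff_derivable; exact: df.
Qed.

(** Freezing the velocity in a function on the tangent bundle; the derivative along [v] is the one
    along [(v, 0)]. Metric coefficients get their regularity this way. *)
Lemma Ck_fst (V W X : normedModType R) k (A : set V) (f : V * W -> X) w :
  Ck k (A `*` setT) f -> Ck k A (fun x => f (x, w)).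
Proof.
elim: k f => [|k IH] f /=.
  move=> cf x /set_mem Ax.
  have cx : {for (x, w), continuous f} by apply: cf; apply: mem_set; split.
  apply: (@continuous_comp _ _ _ (fun x => (x, w)) f x) => //.
  by apply: cvg_pair; [exact: cvg_id|exact: cvg_cst].
move=> [df Df]; split=> [x Ax|v].
  apply: (@differentiable_comp _ _ _ _ (fun x => (x, w)) f); last exact: df.
  by apply: differentiable_pair.
have -> : 'D_v (fun x => f (x, w)) = fun x => 'D_(v, 0) f (x, w).
  apply/funext => x; rewrite [LHS]derive_line [RHS]derive_line.
  suff -> : (fun h : R => f (h *: (v, 0) + (x, w))) = (fun h => f (h *: v + x, w)) by [].
  apply/funext => h.
  have -> : h *: (v, 0) + (x, w) = (h *: v + x, h *: 0 + w) :> (V * W)%type by [].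
  by rewrite scaler0 add0r.
exact: IH (Df (v, 0)).
Qed.

End Calculus.

(** * Symmetry of second derivatives *)

Section Schwarz.
Context {R : realType}.

Lemma near_continuous (V W : normedModType R) (f : V -> W) x e :
  {for x, continuous f} -> 0 < e -> \forall y \near x, `|f x - f y| < e.
Proof. by move=> cf e0; exact: cvgr_dist_lt. Qed.

Lemma nbhs_dist3 (V : normedModType R) (x : V) (A B C : set V) :
  nbhs x A -> nbhs x B -> nbhs x C ->
  exists2 e, 0 < e & forall y, `|x - y| < e -> [/\ A y, B y & C y].
Proof.
move=> nA nB nC; have [e e0 eP] := nbhs_dist (filterI nA (filterI nB nC)).
by exists e => // y /eP[? []].
Qed.

Lemma MVT_derivable (f df : R -> R) (a b : R) : a < b ->
  (forall s, a <= s <= b -> is_derive s 1 f (df s)) ->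
  exists2 c, a <= c <= b & f b - f a = (b - a) * df c.
Proof.
move=> ab fdf; have [|| c cab ->] := @MVT R f df a b ab.
- by move=> s sab; apply: fdf; rewrite !ltW ?(itvP sab).
- apply: derivable_within_continuous => s sab.
  by apply: (@ex_derive _ _ _ _ _ _ (df s)); apply: fdf; rewrite !(itvP sab).
by exists c; [rewrite !ltW ?(itvP cab)|rewrite mulrC].
Qed.

(** Two mean value theorems: along [u] for the increment of [F] by [h *: v], then along [v] for
    ['D_u F]. The left-hand side is symmetric in [u] and [v], the right-hand side is not. *)
Lemma second_difference (V : normedModType R) (A : set V) (F : V -> R) x u v (h : R) :
  0 < h -> Ck 2 A F ->
  (forall s t, 0 <= s <= h -> 0 <= t <= h -> A (t *: v + (s *: u + x))) ->
  exists s t, [/\ 0 <= s <= h, 0 <= t <= h &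
    F (h *: v + (h *: u + x)) - F (h *: u + x) - F (h *: v + x) + F x =
    h * (h * 'D_v ('D_u F) (t *: v + (s *: u + x)))].
Proof.
move=> h0 [dF DF] Auv.
have hh : 0 <= h <= h by rewrite lexx ltW.
have zz : 0 <= (0 : R) <= h by rewrite lexx ltW.
pose phi s := F (s *: u + (h *: v + x)) - F (s *: u + x).
pose dphi s := 'D_u F (s *: u + (h *: v + x)) - 'D_u F (s *: u + x).
have [|s sh Es] := @MVT_derivable phi dphi 0 h h0.
  move=> s sh; apply: is_deriveB; apply: is_derive_along; apply: dF.
    by rewrite addrCA; exact: Auv.
  by have := Auv s 0 sh zz; rewrite scale0r add0r.
pose psi t := 'D_u F (t *: v + (s *: u + x)).
pose dpsi t := 'D_v ('D_u F) (t *: v + (s *: u + x)).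
have [|t th Et] := @MVT_derivable psi dpsi 0 h h0.
  by move=> t th; apply: is_derive_along; have [dDF _] := DF u; apply: dDF; exact: Auv.
exists s, t; split=> //.
move: Es Et; rewrite /phi /dphi /psi /dpsi !subr0 !scale0r !add0r addrCA => Es Et.
by rewrite -Et -[h *: v + (s *: u + x)]addrCA -Es; lra.
Qed.

(** By symmetry of the second difference, the two mixed derivatives take a common value at two
    points near [x], possibly different ones; continuity of both at [x] concludes. *)
Lemma schwarz (V : normedModType R) (A : set V) (F : V -> R) x u v :
  open A -> A x -> Ck 2 A F -> 'D_u ('D_v F) x = 'D_v ('D_u F) x.
Proof.
move=> oA Ax CF; have [dF DF] := CF.
have cuv : {for x, continuous ('D_u ('D_v F))}.
  by have [_ H] := DF v; exact: H u x (mem_set Ax).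
have cvu : {for x, continuous ('D_v ('D_u F))}.
  by have [_ H] := DF u; exact: H v x (mem_set Ax).
apply/eqP; rewrite -subr_eq0 -normr_le0; apply/ler_addgt0Pr => e e0; rewrite add0r.
have e20 : 0 < e / 2 by rewrite divr_gt0.
have [d d0 dP] : exists2 d, 0 < d & forall y, `|x - y| < d ->
    [/\ A y, `|'D_u ('D_v F) x - 'D_u ('D_v F) y| < e / 2 &
        `|'D_v ('D_u F) x - 'D_v ('D_u F) y| < e / 2].
  exact: nbhs_dist3 (near_in oA Ax) (near_continuous cuv e20) (near_continuous cvu e20).
pose w := `|u| + `|v| + 1.
have w0 : 0 < w by rewrite ltr_wpDl// addr_ge0.
(* With this choice [h * w = d / 2], so the whole parallelogram lies in the ball of radius [d]; the
   1 in [w] covers [u = v = 0]. *)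
pose h := d / (2 * w).
have h0 : 0 < h by rewrite divr_gt0// mulr_gt0.
have near_h u' v' s t : `|u'| + `|v'| <= w -> 0 <= s <= h -> 0 <= t <= h ->
    `|x - (t *: v' + (s *: u' + x))| < d.
  move=> uvw /andP[s0 sh] /andP[t0 th].
  rewrite (_ : x - _ = - (t *: v' + s *: u')); last first.
    by rewrite addrA opprD addrCA subrr addr0.
  rewrite normrN (le_lt_trans (ler_normD _ _))// !normrZ !ger0_norm//.
  apply: (@le_lt_trans _ _ (h * w)).
    apply: (@le_trans _ _ (h * (`|u'| + `|v'|))); last by rewrite ler_wpM2l// ltW.
    by rewrite mulrDr addrC lerD// ler_wpM2r.
  by rewrite /h invfM mulrA mulfVK ?gt_eqF// ltr_pdivrMr// ltr_pMr// ltr1n.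
have uvw : `|u| + `|v| <= w by rewrite lerDl.
have vuw : `|v| + `|u| <= w by rewrite addrC.
have [|s [t [sh th E1]]] := second_difference (u := u) (v := v) (x := x) h0 CF.
  by move=> s t sh th; have [] := dP _ (near_h u v s t uvw sh th).
have [|s' [t' [sh' th' E2]]] := second_difference (u := v) (v := u) (x := x) h0 CF.
  by move=> s' t' sh' th'; have [] := dP _ (near_h v u s' t' vuw sh' th').
have [_ _ +] := dP _ (near_h u v s t uvw sh th).
have [_ + _] := dP _ (near_h v u s' t' vuw sh' th').
move: E1 E2; rewrite [h *: u + (h *: v + x)]addrCA.
move: ('D_u _ x) ('D_v _ x) ('D_u _ _) ('D_v _ _) => p q r' r.
move: (F _) (F _) (F _) (F _) => a b c d' E1 E2.
have -> : r' = r.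
  have hn : h != 0 by rewrite gt_eqF.
  by apply: (mulfI hn); apply: (mulfI hn); rewrite -E1 -E2; ring.
move=> h1 h2; rewrite -(subrKA r) (le_trans (ler_normD _ _))// (distrC r).
by rewrite [leRHS](splitr e) lerD// ltW.
Qed.

Lemma schwarz_mx (V : normedModType R) m n (A : set V) (F : V -> 'M[R]_(m, n)) x u v :
  open A -> A x -> Ck 2 A F -> 'D_u ('D_v F) x = 'D_v ('D_u F) x.
Proof.
move=> oA Ax FC; have [dF DF] := FC.
have ent a b i j : ('D_a ('D_b F) x) i j = 'D_a ('D_b (fun y => F y i j)) x.
  have [dDF _] := DF b; rewrite (derive_entry a i j (dDF x Ax)).
  apply: near_eq_derive; apply: filterS (near_in oA Ax) => y Ay.
  exact: derive_entry (dF y Ay).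
apply/matrixP => i j.
exact (etrans (ent u v i j) (etrans (schwarz u v oA Ax (Ck_entry i j oA FC))
  (esym (ent v u i j)))).
Qed.

End Schwarz.

(** * Functions that are Lipschitz near a point *)

Section LocallyLipschitz.
Context {R : realType}.

Definition loclip (V W : normedModType R) (x : V) (f : V -> W) :=
  exists K r, [/\ 0 <= K, 0 < r & forall y z, `|x - y| < r -> `|x - z| < r ->
    `|f y - f z| <= K * `|y - z|].

Lemma loclip_bounded (V W : normedModType R) (x : V) (f : V -> W) : loclip x f ->
  exists M r, [/\ 0 <= M, 0 < r & forall y, `|x - y| < r -> `|f y| <= M].
Proof.
move=> [K [r [K0 r0 fK]]]; exists (`|f x| + K * r), r; split=> // [|y xy].
  by rewrite addr_ge0// mulr_ge0// ltW.
have := fK x y; rewrite subrr normr0 => /(_ r0 xy) H.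
rewrite -(subrK (f x) (f y)) addrC (le_trans (ler_normD _ _))// lerD2l distrC.
by rewrite (le_trans H)// ler_wpM2l// ltW.
Qed.

Lemma loclip_cst (V W : normedModType R) (x : V) (c : W) : loclip x (fun=> c).
Proof. by exists 0, 1; split=> // y z _ _; rewrite subrr normr0 mul0r. Qed.

Lemma loclipD (V W : normedModType R) (x : V) (f g : V -> W) :
  loclip x f -> loclip x g -> loclip x (fun y => f y + g y).
Proof.
move=> [K [r [K0 r0 fK]]] [L [s [L0 s0 gL]]].
exists (K + L), (Num.min r s); split; [exact: addr_ge0|by rewrite lt_min r0|].
move=> y z; rewrite !lt_min => /andP[yr ys] /andP[zr zs].
rewrite opprD addrACA (le_trans (ler_normD _ _))// mulrDl lerD//.
  exact: fK.
exact: gL.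
Qed.

Lemma loclipM (V : normedModType R) (x : V) (f g : V -> R) :
  loclip x f -> loclip x g -> loclip x (fun y => f y * g y).
Proof.
move=> lf lg; have [M [rM [M0 rM0 fM]]] := loclip_bounded lf.
have [N [rN [N0 rN0 gN]]] := loclip_bounded lg.
move: lf lg => [K [r [K0 r0 fK]]] [L [s [L0 s0 gL]]].
exists (K * N + M * L), (Num.min (Num.min r s) (Num.min rM rN)); split.
- by rewrite addr_ge0// mulr_ge0.
- by rewrite !lt_min r0 s0 rM0.
move=> y z; rewrite !lt_min => /andP[/andP[yr ys] /andP[yM yN]].
move=> /andP[/andP[zr zs] /andP[zM zN]].
have -> : f y * g y - f z * g z = (f y - f z) * g y + f z * (g y - g z) by ring.
rewrite (le_trans (ler_normD _ _))// !normrM mulrDl lerD//.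
  by rewrite mulrAC ler_pM//; [exact: fK|exact: gN].
by rewrite -mulrA ler_pM//; [exact: fM|exact: gL].
Qed.

Lemma loclipV (V : normedModType R) (x : V) (f : V -> R) :
  loclip x f -> f x != 0 -> loclip x (fun y => (f y)^-1).
Proof.
move=> lf fx; move: (lf) => [K [r [K0 r0 fK]]].
pose m := `|f x| / 2; have m0 : 0 < m by rewrite divr_gt0// normr_gt0.
(* On this ball [f] moves by at most half of [|f x|], hence stays away from 0; [K + 1] is positive
   even when [K] is 0. *)
pose s := Num.min r (m / (K + 1)).
have K10 : 0 < K + 1 by rewrite ltr_wpDl.
have fm y : `|x - y| < s -> m <= `|f y|.
  rewrite lt_min => /andP[yr ym].
  have := fK x y; rewrite subrr normr0 => /(_ r0 yr) H.
  have : K * `|x - y| <= m.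
    rewrite (@le_trans _ _ ((K + 1) * `|x - y|))// ?ler_wpM2r ?lerDl//.
    by rewrite mulrC -ler_pdivlMr// ltW.
  have := ler_normD (f x - f y) (f y); rewrite subrK /m.
  by move: H; lra.
exists (K / (m * m)), s; split.
- by rewrite divr_ge0// mulr_ge0// ltW.
- by rewrite lt_min r0 divr_gt0.
move=> y z ys zs; have := fm y ys; have := fm z zs => mz my.
have fy0 : f y != 0 by rewrite -normr_gt0 (lt_le_trans m0).
have fz0 : f z != 0 by rewrite -normr_gt0 (lt_le_trans m0).
have -> : (f y)^-1 - (f z)^-1 = (f z - f y) / (f y * f z).
  by field; rewrite fy0 fz0.
rewrite normrM normfV distrC normrM mulrAC ler_pM ?invr_ge0 ?mulr_ge0//.
  by apply: fK; [move: ys|move: zs]; rewrite lt_min => /andP[].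
by rewrite lef_pV2 ?posrE ?mulr_gt0 ?normr_gt0// ler_pM// ltW.
Qed.

Lemma loclip_row (W : normedModType R) m n (z : 'M[R]_(m, n)) i (f : 'rV[R]_n -> W) :
  loclip (row i z) f -> loclip z (fun y => f (row i y)).
Proof.
have rowle (y y' : 'M[R]_(m, n)) : `|row i y - row i y'| <= `|y - y'|.
  apply: mx_norm_le => // k j; rewrite !mxE.
  by have := mx_entry_le (y - y') i j; rewrite !mxE.
move=> [K [r [K0 r0 fK]]]; exists K, r; split=> // y y' yr yr'.
apply: (@le_trans _ _ (K * `|row i y - row i y'|)); last by rewrite ler_wpM2l.
by apply: fK; apply: le_lt_trans (rowle _ _) _.
Qed.

Lemma loclip_entry m n (z : 'M[R]_(m, n)) i j :
  loclip z (fun y : 'M[R]_(m, n) => y i j).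
Proof.
exists 1, 1; split=> // y y' _ _; rewrite mul1r.
by have := mx_entry_le (y - y') i j; rewrite !mxE.
Qed.

Lemma uniform_bounds (I : finType) (P : I -> R -> R -> Prop) :
  (forall i, exists K r, 0 < r /\ P i K r) ->
  (forall i K r K' r', K <= K' -> 0 < r' <= r -> P i K r -> P i K' r') ->
  exists K r, [/\ 0 <= K, 0 < r & forall i, P i K r].
Proof.
move=> exKr mono.
have /choice[k kP] : forall i, exists kr : R * R, 0 < kr.2 /\ P i kr.1 kr.2.
  by move=> i; have [K [r [r0 Pi]]] := exKr i; exists (K, r).
(* The sum of absolute values dominates each constant and is nonnegative; the minimum starts from 1
   and so is positive even for an empty [I]. *)
exists (\sum_i `|(k i).1|), (\big[Num.min/1]_i (k i).2).
have r0 : 0 < \big[Num.min/1]_i (k i).2.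
  by elim/big_ind: _ => // [x y x0 y0|i _]; [rewrite lt_min x0|have [] := kP i].
split=> // [|i]; first by apply: sumr_ge0.
apply: mono (kP i).2; last by rewrite r0 bigmin_le.
rewrite (bigD1 i)//= (le_trans (ler_norm _))// lerDl; exact: sumr_ge0.
Qed.

Lemma loclip_mx (V : normedModType R) m n (x : V) (f : V -> 'M[R]_(m, n)) :
  (forall i j, loclip x (fun y => f y i j)) -> loclip x f.
Proof.
move=> lf; pose P (ij : 'I_m * 'I_n) K r := 0 <= K /\ forall y z,
  `|x - y| < r -> `|x - z| < r -> `|f y ij.1 ij.2 - f z ij.1 ij.2| <= K * `|y - z|.
have [||K [r [K0 r0 KrP]]] := @uniform_bounds _ P.
- by move=> [i j]; have [K [r [K0 r0 H]]] := lf i j; exists K, r.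
- move=> i K r K' r' KK' /andP[_ rr'] [K0 H]; split; first exact: le_trans KK'.
  move=> y z yr zr; apply: (@le_trans _ _ (K * `|y - z|)); last by rewrite ler_wpM2r.
  by apply: H; [exact: lt_le_trans yr _|exact: lt_le_trans zr _].
exists K, r; split=> // y z yr zr; apply: mx_norm_le => [|i j].
  by rewrite mulr_ge0.
by rewrite !mxE; have [_ /(_ y z yr zr)] := KrP (i, j).
Qed.

(** The finitely many partial derivatives are continuous at [x], hence bounded by a common [K] on a
    ball; the mean value theorem on segments of this convex ball gives the constant [n%:R * K]. *)
Lemma C1_loclip n (A : set 'rV[R]_n) (F : 'rV[R]_n -> R) x :
  open A -> A x -> Ck 1 A F -> loclip x F.
Proof.
move=> oA Ax [dF DF].
pose P (i : 'I_n) K r := forall y, `|x - y| < r -> `|'D_(delta_mx 0 i) F y| <= K.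
have [||K [r [K0 r0 KrP]]] := @uniform_bounds _ P.
- move=> i; have c : {for x, continuous ('D_(delta_mx 0 i) F)}.
    by apply: (DF (delta_mx 0 i)); exact: mem_set.
  have /nbhs_dist[r r0 rP] := near_continuous c ltr01.
  exists (`|'D_(delta_mx 0 i) F x| + 1), r; split=> // y /rP /ltW H.
  rewrite -(subrK ('D_(delta_mx 0 i) F x) ('D_(delta_mx 0 i) F y)) addrC.
  by rewrite (le_trans (ler_normD _ _))// lerD2l distrC.
- move=> i K r K' r' KK' /andP[_ rr'] H y yr; rewrite (le_trans (H y _))//.
  exact: lt_le_trans yr _.
have /nbhs_dist[s s0 sA] := near_in oA Ax.
exists (n%:R * K), (Num.min r s); split; [by rewrite mulr_ge0|by rewrite lt_min r0|].
move=> y z ys zs.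
have seg (t : R) : 0 <= t <= 1 -> `|x - (t *: (y - z) + z)| < Num.min r s.
  move=> /andP[t0 t1].
  have -> : x - (t *: (y - z) + z) = t *: (x - y) + (1 - t) *: (x - z).
    apply/rowP => i; rewrite !mxE; ring.
  rewrite (le_lt_trans (ler_normD _ _))// !normrZ !ger0_norm ?subr_ge0//.
  (* Strictness comes from [y], whose weight is [t]; when [t = 0] the point is [z] itself. *)
  have [->|tn] := eqVneq t 0; first by rewrite mul0r add0r subr0 mul1r.
  have tp : 0 < t by rewrite lt_neqAle eq_sym tn.
  have H1 : t * `|x - y| < t * Num.min r s by rewrite ltr_pM2l.
  have H2 : (1 - t) * `|x - z| <= (1 - t) * Num.min r s.
    by rewrite ler_wpM2l ?subr_ge0// ltW.
  by move: H1 H2; lra.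
have := @MVT_dist R (fun t => F (t *: (y - z) + z))
  (fun t => 'D_(y - z) F (t *: (y - z) + z)) (n%:R * K * `|y - z|) 0 1 ler01.
rewrite scale1r subrK scale0r add0r subr0 mulr1; apply.
- move=> t t01; apply: is_derive_along; apply: dF; apply: sA.
  by have := seg t t01; rewrite lt_min => /andP[].
- move=> t t01; have := seg t t01; rewrite lt_min => /andP[tr ts].
  rewrite derive_basis; last by apply: dF; exact: sA.
  rewrite (le_trans (ler_norm_sum _ _ _))//.
  have -> : n%:R * K * `|y - z| = \sum_(i < n) (`|y - z| * K).
    by rewrite sumr_const card_ord -mulr_natl; ring.
  apply: ler_sum => i _; rewrite normrZ ler_pM//; first exact: mx_entry_le.
  exact: KrP.
Qed.

(** A Lipschitz constant bounds the difference quotients and hence their limit. The bound is linear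
    in [v] and uniform in [y], as needed when both the point and the direction move along a
    motion. *)
Lemma derive_loclip (V W : normedModType R) (F : V -> W) x : loclip x F ->
  exists K r, [/\ 0 <= K, 0 < r & forall y v, `|x - y| < r -> differentiable F y ->
    `|'D_v F y| <= K * `|v|].
Proof.
move=> [K [r [K0 r0 FK]]]; exists K, r; split=> // y v xy dF.
have /cvg_norm H : (fun h => h^-1 *: ((F \o shift y) (h *: v) - F y)) @ 0^' --> 'D_v F y.
  exact: diff_derivable.
rewrite -(cvg_lim _ H)//; apply: limr_le; first exact: cvgP H.
have e0 : 0 < (r - `|x - y|) / (`|v| + 1) by rewrite divr_gt0 ?subr_gt0// ltr_wpDl.
near=> h.
have h0 : h != 0 by near: h; exact: nbhs_dnbhs_neq.
rewrite /= normrZ normfV -ler_pdivlMl ?invr_gt0 ?normr_gt0// invrK.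
rewrite mulrCA -normrZ -[X in _ <= _ * `|X|](addrK y) FK//.
rewrite opprD addrCA (le_lt_trans (ler_normD _ _))// normrN normrZ -ltrBrDr.
have v1 : 0 < `|v| + 1 by rewrite ltr_wpDl.
have H1 : `|h| * (`|v| + 1) < r - `|x - y|.
  by rewrite -ltr_pdivlMr//; near: h; exact: dnbhs0_lt.
apply: le_lt_trans H1.
by rewrite ler_wpM2l// lerDl.
Unshelve. all: by end_near. Qed.
End LocallyLipschitz.

(** * Determinants and adjugates in classes closed under sums and products *)

Section DetClosure.
Context {R : realType} {V : Type} (P : (V -> R) -> Prop).
Hypothesis Pcst : forall c, P (fun=> c).
Hypothesis PD : forall f g, P f -> P g -> P (fun x => f x + g x).
Hypothesis PM : forall f g, P f -> P g -> P (fun x => f x * g x).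

Lemma closed_sum (I : Type) (r : seq I) (Q : pred I) (F : I -> V -> R) :
  (forall i, P (F i)) -> P (fun x => \sum_(i <- r | Q i) F i x).
Proof.
move=> PF; elim: r => [|i r IH].
  by under eq_fun do rewrite big_nil; exact: Pcst.
under eq_fun do rewrite big_cons.
by case: (Q i) => //; exact: PD.
Qed.

Lemma closed_prod (I : Type) (r : seq I) (Q : pred I) (F : I -> V -> R) :
  (forall i, P (F i)) -> P (fun x => \prod_(i <- r | Q i) F i x).
Proof.
move=> PF; elim: r => [|i r IH].
  by under eq_fun do rewrite big_nil; exact: Pcst.
under eq_fun do rewrite big_cons.
by case: (Q i) => //; exact: PM.
Qed.

(** The Leibniz formula is a polynomial in the entries. One proof serves for local Lipschitz
    continuity and for differentiability. *)
Lemma closed_det n (A : V -> 'M[R]_n) : (forall i j, P (fun x => A x i j)) ->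
  P (fun x => \det (A x)).
Proof.
move=> PA; rewrite /determinant; apply: closed_sum => s.
by apply: PM; [exact: Pcst|apply: closed_prod => i].
Qed.

Lemma closed_adj n (A : V -> 'M[R]_n) : (forall i j, P (fun x => A x i j)) ->
  forall i j, P (fun x => \adj (A x) i j).
Proof.
move=> PA i j; under eq_fun do rewrite mxE /cofactor.
apply: PM; first exact: Pcst.
by apply: closed_det => k l; under eq_fun do rewrite !mxE.
Qed.

End DetClosure.

(** * Bilinear forms *)

Section BilinearForms.
Context {R : realType}.

Lemma is_derive_sumf (V : normedModType R) n (f : 'I_n -> V -> R) x v (df : 'I_n -> R) :
  (forall k, is_derive x v (f k) (df k)) ->
  is_derive x v (fun y => \sum_k f k y) (\sum_k df k).
Proof.
move=> fdf; have -> : (fun y => \sum_k f k y) = \sum_k f k.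
  by apply/funext => y; rewrite fct_sumE.
exact: is_derive_sum.
Qed.

Lemma is_deriveMf (V : normedModType R) (f g : V -> R) x v df dg :
  is_derive x v f df -> is_derive x v g dg ->
  is_derive x v (fun y => f y * g y) (df * g x + f x * dg).
Proof.
move=> Df Dg; have := is_deriveM Df Dg => D.
by apply: is_derive_eq; rewrite addrC [g x *: _]mulrC.
Qed.

Lemma is_deriveMc (V : normedModType R) (f : V -> R) x v df c :
  is_derive x v f df -> is_derive x v (fun y => f y * c) (df * c).
Proof.
move=> Df; have := is_deriveMf Df (is_derive_cst c x v) => D.
by apply: is_derive_eq; rewrite mulr0 addr0.
Qed.

Definition bil n (M : 'M[R]_n) (v w : 'rV[R]_n) : R := (v *m M *m w^T) 0 0.

Lemma bilE n (M : 'M[R]_n) v w : bil M v w = \sum_i \sum_j M i j * v 0 i * w 0 j.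
Proof.
rewrite /bil mxE exchange_big/=; apply: eq_bigr => j _; rewrite !mxE mulr_suml.
by apply: eq_bigr => i _; rewrite (mulrC (v 0 i)).
Qed.

Lemma bil_row n (M : 'M[R]_n) v w : bil M v w = \sum_j (v *m M) 0 j * w 0 j.
Proof. by rewrite /bil mxE; apply: eq_bigr => j _; rewrite [w^T _ _]mxE. Qed.

Lemma bil_delta n (M : 'M[R]_n) v k : bil M v (delta_mx 0 k) = (v *m M) 0 k.
Proof.
rewrite bil_row (bigD1 k)//= big1 ?addr0 => [|j jk]; rewrite [delta_mx _ _ _ _]mxE eqxx/=.
  by rewrite eqxx mulr1.
by rewrite (negbTE jk) mulr0.
Qed.

Lemma bilZl n (M : 'M[R]_n) a v w : bil M (a *: v) w = a * bil M v w.
Proof. by rewrite /bil -!scalemxAl mxE. Qed.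

Lemma bilZr n (M : 'M[R]_n) a v w : bil M v (a *: w) = a * bil M v w.
Proof. by rewrite /bil linearZ/= -scalemxAr mxE. Qed.

Lemma bilBm n (M N : 'M[R]_n) v w : bil (M - N) v w = bil M v w - bil N v w.
Proof. by rewrite /bil mulmxBr mulmxBl !mxE. Qed.

Lemma bil0l n (M : 'M[R]_n) w : bil M 0 w = 0.
Proof. by rewrite /bil !mul0mx mxE. Qed.

Lemma bil_sym n (M : 'M[R]_n) v w : (forall i j, M i j = M j i) ->
  bil M v w = bil M w v.
Proof.
move=> Ms; rewrite !bilE exchange_big/=; apply: eq_bigr => j _; apply: eq_bigr => i _.
by rewrite Ms mulrAC.
Qed.

(** The norm is the largest entry in absolute value, and the double sum has [n * n] terms. *)
Lemma bil_bound n (M : 'M[R]_n) v w : `|bil M v w| <= n%:R * n%:R * `|M| * `|v| * `|w|.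
Proof.
rewrite bilE (le_trans (ler_norm_sum _ _ _))//.
have -> : n%:R * n%:R * `|M| * `|v| * `|w| =
    \sum_(i < n) \sum_(j < n) `|M| * `|v| * `|w|.
  by rewrite !sumr_const !card_ord -mulrnA -[RHS]mulr_natl natrM !mulrA.
apply: ler_sum => i _; rewrite (le_trans (ler_norm_sum _ _ _))//.
by apply: ler_sum => j _; rewrite !normrM !ler_pM// mx_entry_le.
Qed.

Lemma bil_bound2 n (M : 'M[R]_n) w : `|bil M w w| <= n%:R * n%:R * `|M| * `|w| ^+ 2.
Proof. by rewrite (le_trans (bil_bound _ _ _))// -mulrA [`|w| ^+ 2]expr2. Qed.

Lemma is_derive_bil (V : normedModType R) n (M : V -> 'M[R]_n) (v w : V -> 'rV[R]_n)
    x e dM dv dw :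
  is_derive x e M dM -> is_derive x e v dv -> is_derive x e w dw ->
  is_derive x e (fun y => bil (M y) (v y) (w y))
    (bil dM (v x) (w x) + bil (M x) dv (w x) + bil (M x) (v x) dw).
Proof.
move=> DM Dv Dw; under eq_fun do rewrite bilE; rewrite !bilE -!big_split/=.
apply: is_derive_sumf => i; rewrite -!big_split/=; apply: is_derive_sumf => j.
have DMij := is_derive_entry i j DM.
have Dvi := is_derive_entry 0 i Dv; have Dwj := is_derive_entry 0 j Dw.
have := is_deriveMf (is_deriveMf DMij Dvi) Dwj => D.
by apply: is_derive_eq; rewrite mulrDl.
Qed.

Lemma bil_unit n (M : 'M[R]_n) : (forall w, w != 0 -> 0 < bil M w w) -> \det M != 0.
Proof.
move=> Mp; apply/negP => /det0P[w w0 wM].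
by have := Mp w w0; rewrite /bil wM mul0mx mxE ltxx.
Qed.

(** The constant is the minimum of the form on the unit sphere, which is compact; homogeneity of
    degree 2 extends the bound to all vectors. *)
Lemma bil_lower n (M : 'M[R]_n) : (forall w, w != 0 -> 0 < bil M w w) ->
  exists2 c, 0 < c & forall w, c * `|w| ^+ 2 <= bil M w w.
Proof.
(* In dimension 0 the sphere is empty and any constant will do. *)
move=> Mp; have [[w0 w0n]|all0] := pselect (exists w : 'rV[R]_n, w != 0); last first.
  exists 1 => // w; have -> : w = 0 by apply/eqP/negPn/negP => w0; apply: all0; exists w.
  by rewrite normr0 expr0n mulr0 bil0l.
pose S := [set w : 'rV[R]_n | `|w| = 1].
have nrm (w : 'rV[R]_n) : w != 0 -> S (`|w|^-1 *: w).
  by move=> w0'; rewrite /S/= normrZ normfV normr_id mulVf// normr_eq0.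
have cb : continuous (fun w : 'rV[R]_n => bil M w w).
  move=> w; apply: differentiable_continuous.
  have -> : (fun w : 'rV[R]_n => bil M w w) =
      \sum_i \sum_j (fun w : 'rV[R]_n => M i j * w 0 i * w 0 j).
    apply/funext => w'; rewrite bilE fct_sumE; apply: eq_bigr => i _.
    by rewrite fct_sumE.
  apply: differentiable_sum => i; apply: differentiable_sum => j.
  apply: differentiableM; last exact: differentiable_coord.
  by apply: differentiableM; [exact: differentiable_cst|exact: differentiable_coord].
have [|||c /set_mem Sc cmin] := @EVT_min_rV R n (fun w => bil M w w) S.
- by exists (`|w0|^-1 *: w0); exact: nrm.
- apply: bounded_closed_compact.
    exists 1; split; first exact: num_real.
    by move=> x x1 w /= ->; exact: ltW.
  have -> : S = (fun w : 'rV[R]_n => `|w|) @^-1` [set 1] by [].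
  apply: closed_comp; last exact: closed_eq.
  by move=> w _; exact: norm_continuous.
- exact: continuous_subspaceT.
have c0 : c != 0 by rewrite -normr_gt0 Sc.
exists (bil M c c); first exact: Mp.
move=> w; have [->|w0'] := eqVneq w 0; first by rewrite normr0 expr0n mulr0 bil0l.
have := cmin _ (mem_set (nrm w w0')); rewrite bilZl bilZr mulrA -expr2 exprVn.
by rewrite ler_pdivlMl ?exprn_gt0 ?normr_gt0// mulrC.
Qed.

End BilinearForms.

(** * Mechanical systems on open subsets of R^n *)

(** The clause of [EL_solution] for one chart, isolated so that the equations can be studied on open
    subsets of R^n; the two are convertible. *)
Definition EL_at (R : realType) n (L : 'rV[R]_n * 'rV[R]_n -> R) (q : R -> 'rV[R]_n)
    (t : R) :=
  [/\ derivable q t 1, derivable (derive1 q) t 1 &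
      forall k : 'I_n,
        is_derive t 1
          (fun s => 'D_((0 : 'rV[R]_n), (delta_mx 0 k : 'rV[R]_n)) L (q s, derive1 q s))
          ('D_((delta_mx 0 k : 'rV[R]_n), (0 : 'rV[R]_n)) L (q t, derive1 q t))].

Section LocalMechanics.
Context {R : realType} {n : nat} (A : set 'rV[R]_n) (h : 'rV[R]_n -> 'M[R]_n)
  (u : 'rV[R]_n -> R).
Hypotheses (oA : open A) (hC : Ck 2 A h) (uC : Ck 2 A u)
  (hsym : forall q i j, h q i j = h q j i)
  (hpos : forall q, A q -> forall w, w != 0 -> 0 < bil (h q) w w).

Definition Lloc (qw : 'rV[R]_n * 'rV[R]_n) : R := bil (h qw.1) qw.2 qw.2 / 2 - u qw.1.

(** Along a fibre [Lloc] is a quadratic polynomial in the velocity. The formula identifies the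
    momentum as the row vector [w *m h q]. *)
Lemma Lloc_dv q w e : is_derive (q, w) (0, e) Lloc (bil (h q) w e).
Proof.
apply: is_derive_line.
have -> : (fun t : R => Lloc (t *: (0, e) + (q, w))) =
    (fun t : R => bil (h q) (t *: e + w) (t *: e + w) / 2 - u q).
  apply/funext => t.
  have -> : t *: (0, e) + (q, w) = (t *: 0 + q, t *: e + w) :> ('rV[R]_n * 'rV[R]_n)%type by [].
  by rewrite scaler0 add0r.
have Dw : is_derive (0 : R) 1 (fun t : R => t *: e + w) e by exact: is_derive_affine.
have := is_derive_bil (is_derive_cst (h q) (0 : R) 1) Dw Dw.
rewrite !scale0r !add0r => D.
apply: (is_derive_eq (is_deriveB (is_deriveMc 2^-1 D) (is_derive_cst (u q) (0 : R) 1))).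
rewrite /cst (bil_sym e w (hsym q)) subr0.
have -> : bil (0 : 'M[R]_n) w w = 0 by rewrite /bil mulmx0 mul0mx mxE.
by rewrite add0r; lra.
Qed.

Lemma hD q : A q -> forall e, is_derive q e h ('D_e h q).
Proof. by move=> Aq e; apply: derivableP; apply: diff_derivable; have [H _] := hC; exact: H. Qed.

Lemma uD q : A q -> forall e, is_derive q e u ('D_e u q).
Proof. by move=> Aq e; apply: derivableP; apply: diff_derivable; have [H _] := uC; exact: H. Qed.

Lemma is_derive_lineP (V W : normedModType R) (f : V -> W) x v d :
  is_derive x v f d -> is_derive (0 : R) 1 (fun t : R => f (t *: v + x)) d.
Proof.
move=> [df <-]; apply: DeriveDef; first exact: ((derivable1P f x v).1 df).
by rewrite [RHS]derive_line.
Qed.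

Lemma Lloc_dq q w e : A q ->
  is_derive (q, w) (e, 0) Lloc (bil ('D_e h q) w w / 2 - 'D_e u q).
Proof.
move=> Aq; apply: is_derive_line.
have -> : (fun t : R => Lloc (t *: (e, 0) + (q, w))) =
    (fun t : R => bil (h (t *: e + q)) w w / 2 - u (t *: e + q)).
  apply/funext => t.
  have -> : t *: (e, 0) + (q, w) = (t *: e + q, t *: 0 + w) :> ('rV[R]_n * 'rV[R]_n)%type by [].
  by rewrite scaler0 add0r.
have Dh := is_derive_lineP (hD Aq e); have Du := is_derive_lineP (uD Aq e).
have := is_derive_bil Dh (is_derive_cst w (0 : R) 1) (is_derive_cst w (0 : R) 1) => D.
apply: (is_derive_eq (is_deriveB (is_deriveMc 2^-1 D) Du)); rewrite /cst.
have -> : bil (h (0 *: e + q)) w 0 = 0 by rewrite /bil trmx0 mulmx0 mxE.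
by rewrite bil0l !addr0.
Qed.

(** Cramer's formula: polynomials in the entries divided by the determinant, so that regularity
    follows from the closure lemmas. *)
Definition hinv q : 'M[R]_n := (\det (h q))^-1 *: \adj (h q).

Lemma hinvK q : A q -> hinv q *m h q = 1%:M.
Proof.
move=> Aq; rewrite /hinv -scalemxAl mul_adj_mx -mul_scalar_mx -scalar_mxM mulVf//.
exact: bil_unit (hpos Aq).
Qed.

Lemma h_loclip q i j : A q -> loclip q (fun q => h q i j).
Proof. by move=> Aq; apply: (C1_loclip oA Aq); apply: Ck_entry => //; exact: CkS. Qed.

Lemma h_diff q i j : A q -> differentiable (fun q => h q i j) q.
Proof. by move=> Aq; have [H _] := Ck_entry i j oA hC; exact: H. Qed.

Lemma hinv_loclip q i j : A q -> loclip q (fun q => hinv q i j).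
Proof.
move=> Aq; under eq_fun do rewrite mxE.
apply: loclipM.
  apply: loclipV; last exact: bil_unit (hpos Aq).
  apply: (@closed_det _ _ (loclip q)) => [c|f g|f g|k l].
  - exact: loclip_cst.
  - exact: loclipD.
  - exact: loclipM.
  - exact: h_loclip.
apply: (@closed_adj _ _ (loclip q)) => [c|f g|f g|k l].
- exact: loclip_cst.
- exact: loclipD.
- exact: loclipM.
- exact: h_loclip.
Qed.

Lemma hinv_diff q i j : A q -> differentiable (fun q => hinv q i j) q.
Proof.
move=> Aq; pose P (f : 'rV[R]_n -> R) := differentiable f q.
have PM f g : P f -> P g -> P (fun q => f q * g q) by exact: differentiableM.
have PD f g : P f -> P g -> P (fun q => f q + g q) by exact: differentiableD.
have Pcst c : P (fun=> c) by exact: differentiable_cst.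
under eq_fun do rewrite mxE.
apply: (PM (fun q => (\det (h q))^-1) (fun q => \adj (h q) i j)).
  apply: (@differentiableV _ _ (fun q => \det (h q))); last exact: bil_unit (hpos Aq).
  by apply: (closed_det Pcst PD PM) => k l; exact: h_diff.
by apply: (closed_adj Pcst PD PM) => k l; exact: h_diff.
Qed.

Lemma hinvKV q : A q -> h q *m hinv q = 1%:M.
Proof. by move=> Aq; apply: mulmx1C; exact: hinvK. Qed.

Lemma D_h_loclip q e i j : A q -> loclip q (fun q => ('D_e h q) i j).
Proof.
move=> Aq; apply: (C1_loclip oA Aq); apply: Ck_entry => //.
by have [_ H] := hC; exact: H.
Qed.

Lemma D_u_loclip q e : A q -> loclip q ('D_e u).
Proof. by move=> Aq; apply: (C1_loclip oA Aq); have [_ H] := uC; exact: H. Qed.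

Lemma loclip_bil (V : normedModType R) m (M : V -> 'M[R]_m) (v : V -> 'rV[R]_m) x :
  (forall i j, loclip x (fun y => M y i j)) -> (forall j, loclip x (fun y => v y 0 j)) ->
  loclip x (fun y => bil (M y) (v y) (v y)).
Proof.
move=> lM lv; under eq_fun do rewrite bilE.
have LS (F : 'I_m -> V -> R) : (forall i, loclip x (F i)) -> loclip x (fun y => \sum_i F i y).
  apply: (@closed_sum _ _ (loclip x)) => [c|f g]; [exact: loclip_cst|exact: loclipD].
by apply: (LS _) => i; apply: (LS _) => j; apply: loclipM => //; apply: loclipM.
Qed.

(** These are Hamilton's equations: [W] recovers the velocity from the momentum, and the second row
    of [G] is the force, the position derivative of [Lloc]. *)
Lemma local_existence q0 w0 : A q0 -> exists2 d, 0 < d &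
  exists q : R -> 'rV[R]_n, [/\ q 0 = q0, derive1 q 0 = w0 &
    forall t : R, `|t| < d -> A (q t) /\ EL_at Lloc q t].
Proof.
move=> Aq0.
(* The rows of the state are the position [q] and the momentum [w *m h q]. *)
pose W (z : 'M[R]_(2, n)) := row ord_max z *m hinv (row ord0 z).
pose G (z : 'M[R]_(2, n)) : 'M[R]_(2, n) := \matrix_(i, j) if i == ord0 then W z 0 j
  else bil ('D_(delta_mx 0 j) h (row ord0 z)) (W z) (W z) / 2
       - 'D_(delta_mx 0 j) u (row ord0 z).
pose z0 : 'M[R]_(2, n) := \matrix_(i, j) if i == ord0 then q0 0 j else (w0 *m h q0) 0 j.
have z0q : row ord0 z0 = q0 by apply/rowP => j; rewrite !mxE.
have z0p : row ord_max z0 = w0 *m h q0 by apply/rowP => j; rewrite mxE mxE.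
have lW j : loclip z0 (fun z => W z 0 j).
  rewrite /W; under eq_fun do rewrite mxE.
  apply: (@closed_sum _ _ (loclip z0)) => [c|f g|k]; [exact: loclip_cst|exact: loclipD|].
  apply: loclipM; first by under eq_fun do rewrite mxE; exact: loclip_entry.
  by apply: (@loclip_row _ _ _ _ z0 ord0 (fun q => hinv q k j)); rewrite z0q; exact: hinv_loclip.
have lG : loclip z0 G.
  apply: loclip_mx => i j; rewrite /G; under eq_fun do rewrite mxE.
  case: (i == ord0) => //; apply: loclipD.
    apply: loclipM; last exact: loclip_cst.
    apply: loclip_bil => // k l.
    apply: (@loclip_row _ _ _ _ z0 ord0 (fun q => ('D_(delta_mx 0 j) h q) k l)).
    by rewrite z0q; exact: D_h_loclip.
  under eq_fun do rewrite -mulN1r; apply: loclipM; first exact: loclip_cst.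
  apply: (@loclip_row _ _ _ _ z0 ord0 ('D_(delta_mx 0 j) u)).
  by rewrite z0q; exact: D_u_loclip.
have [K [r [K0 r0 GK]]] := lG.
(* Half the radius passes from the open balls of [loclip] to the closed ones of [picard]. *)
have [|d d0 [z [z00 zD]]] := @picard R 2 n G z0 K (r / 2) (divr_gt0 r0 (ltr0n _ 2)).
  move=> y y' yr yr'; apply: GK; rewrite distrC;
    [apply: le_lt_trans yr _|apply: le_lt_trans yr' _]; lra.
have [e e0 eA] := nbhs_dist (near_in oA Aq0).
have cz : {for 0, continuous z}.
  apply/differentiable_continuous/derivable1_diffP.
  by have [] := zD 0 (_ : `|0| < d); rewrite ?normr0.
have [d1 d10 d1P] := nbhs_dist (near_continuous cz e0).
pose q t := row ord0 (z t).
have qA t : `|t| < d1 -> A (q t).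
  move=> td; apply: eA; apply: le_lt_trans (d1P t _); last by rewrite sub0r normrN.
  rewrite z00 -z0q; apply: mx_norm_le => // i j; rewrite !mxE.
  by have := mx_entry_le (z0 - z t) ord0 j; rewrite !mxE.
have qD (t : R) : `|t| < d -> is_derive t 1 q (W (z t)).
  move=> td; apply: is_derive_mx => i j; rewrite ord1 /q.
  under eq_fun do rewrite mxE.
  by have := is_derive_entry ord0 j (zD t td); rewrite /G mxE.
have q'E t : `|t| < d -> derive1 q t = W (z t).
  by move=> td; rewrite derive1E; have [_] := qD t td.
pose d2 := Num.min d d1.
exists d2; first by rewrite lt_min d0.
have near_d (t : R) : `|t| < d2 -> \forall s \near t, `|s| < d2.
  move=> td; have := near_dist t (_ : 0 < d2 - `|t|); rewrite subr_gt0 => /(_ td).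
  apply: filterS => s ts; rewrite -(subrK t s) (le_lt_trans (ler_normD _ _))//.
  by rewrite -ltrBrDr distrC.
exists q; split.
- by rewrite /q z00.
- by rewrite q'E ?normr0// /W z00 z0p z0q -mulmxA hinvKV// mulmx1.
move=> t td; have := td; rewrite lt_min => /andP[td0 td1].
have Aqt := qA t td1; split=> //; split.
- by have [] := qD t td0.
- apply: (near_eq_derivable (f := W \o z)).
    apply: filterS (near_d t td) => s; rewrite lt_min => /andP[sd _].
    by rewrite q'E.
  (* The velocity is the product of the momentum with [hinv] along the motion, both differentiable
     in time; hence the second derivative exists. *)
  apply/derivable_mxP => i j; rewrite ord1 /W/=; under eq_fun do rewrite mxE.
  have Dk k : derivable (fun s => (row ord_max (z s)) 0 k * hinv (q s) k j) t 1.
    apply: derivableM.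
      under eq_fun do rewrite mxE; have := is_derive_entry ord_max k (zD t td0).
      by case.
    by have [] := is_derive_curve (hinv_diff k j Aqt) (qD t td0).
  by have [] := is_derive_sumf (fun k => derivableP (Dk k)).
- move=> k.
  have -> : 'D_(delta_mx 0 k, 0) Lloc (q t, derive1 q t) = G (z t) ord_max k.
    by rewrite q'E// mxE; have [_ ->] := Lloc_dq (W (z t)) (delta_mx 0 k) Aqt.
  apply: (near_eq_is_derive (f := fun s => z s ord_max k)); last first.
    exact: is_derive_entry (zD t td0).
  apply: filterS (near_d t td) => s; rewrite lt_min => /andP[sd sd1].
  have [_ ->] := Lloc_dv (q s) (derive1 q s) (delta_mx 0 k).
  rewrite bil_delta q'E// /W -mulmxA -/(q s) hinvK ?mulmx1 ?mxE//.
  exact: qA.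
Qed.

Lemma bil_summ m l (a : 'I_l -> R) (M : 'I_l -> 'M[R]_m) v w :
  bil (\sum_k a k *: M k) v w = \sum_k a k * bil (M k) v w.
Proof.
rewrite /bil mulmx_sumr mulmx_suml summxE; apply: eq_bigr => k _.
by rewrite -scalemxAr -scalemxAl mxE.
Qed.

(* The Euler-Lagrange equations contracted with a vector field along the motion:
   the acceleration never has to be solved for. *)
Lemma EL_pairing q t (Y : R -> 'rV[R]_n) dY : A (q t) -> EL_at Lloc q t ->
  is_derive t 1 Y dY ->
  is_derive t 1 (fun s => bil (h (q s)) (derive1 q s) (Y s))
    (bil ('D_(Y t) h (q t)) (derive1 q t) (derive1 q t) / 2 - 'D_(Y t) u (q t)
     + bil (h (q t)) (derive1 q t) dY).
Proof.
move=> Aq [dq ddq EL] DY; set w := derive1 q.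
have DP k : is_derive t 1 (fun s => (w s *m h (q s)) 0 k)
    (bil ('D_(delta_mx 0 k) h (q t)) (w t) (w t) / 2 - 'D_(delta_mx 0 k) u (q t)).
  have [_ <-] := Lloc_dq (w t) (delta_mx 0 k) Aq.
  apply: near_eq_is_derive (EL k); near=> s.
  by have [_ ->] := Lloc_dv (q s) (derive1 q s) (delta_mx 0 k); rewrite bil_delta.
under eq_fun do rewrite bil_row.
have D := is_derive_sumf (fun k => is_deriveMf (DP k) (is_derive_entry 0 k DY)).
apply: is_derive_eq; rewrite big_split/= [bil _ _ dY]bil_row; congr (_ + _).
have [dh _] := hC; have [du _] := uC.
have -> : bil ('D_(Y t) h (q t)) (w t) (w t) =
    \sum_k Y t 0 k * bil ('D_(delta_mx 0 k) h (q t)) (w t) (w t).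
  by rewrite (derive_basis (Y t) (dh _ Aq)); exact: bil_summ.
rewrite (derive_basis (Y t) (du _ Aq)).
rewrite mulr_suml -sumrB; apply: eq_bigr => k _.
by rewrite mulrBl mulrAC [X in X / 2]mulrC [X in _ - X]mulrC.
Unshelve. all: by end_near. Qed.

Lemma is_derive_derive1 (V : normedModType R) (f : R -> V) (t : R) :
  derivable f t 1 -> is_derive t 1 f (derive1 f t).
Proof. by move=> df; apply: DeriveDef => //; rewrite derive1E. Qed.

Definition energy q (t : R) := bil (h (q t)) (derive1 q t) (derive1 q t) / 2 + u (q t).

(** The derivative of twice the kinetic energy is computed twice: by [EL_pairing] with the velocity
    as the field, and by the product rule. Equating the two results eliminates the acceleration. *)
Lemma energy_derive q t : A (q t) -> EL_at Lloc q t -> is_derive t 1 (energy q) 0.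
Proof.
move=> Aq EL; have [dq ddq _] := EL.
have Dq := is_derive_derive1 dq; have Dw := is_derive_derive1 ddq.
have [dh _] := hC; have [du _] := uC.
have Dh := is_derive_curve (dh _ Aq) Dq; have Du := is_derive_curve (du _ Aq) Dq.
have [_ D1] := EL_pairing Aq EL Dw.
have D2 := is_derive_bil Dh Dw Dw; have [_ D2'] := D2.
apply: (is_derive_eq (is_deriveD (is_deriveMc 2^-1 D2) Du)).
move: D2'; rewrite {}D1 (bil_sym (derive1 (derive1 q) t) _ (hsym (q t))).
rewrite -[(h \o q) t]/(h (q t)).
move: (bil ('D_ _ h _) _ _) (bil (h (q t)) _ _) ('D__ u _) => a b d.
by lra.
Qed.

Lemma near_derive1 (V : normedModType R) (f g : R -> V) (t : R) :
  (\forall s \near t, f s = g s) -> \forall s \near t, derive1 f s = derive1 g s.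
Proof.
move=> /nbhs_interior; apply: filterS => s fgs.
by rewrite !derive1E; apply: near_eq_derive.
Qed.

Lemma EL_at_near (L : 'rV[R]_n * 'rV[R]_n -> R) (q1 q2 : R -> 'rV[R]_n) (t : R) :
  (\forall s \near t, q1 s = q2 s) -> EL_at L q1 t -> EL_at L q2 t.
Proof.
move=> q12 [dq ddq EL]; have dq12 := near_derive1 q12; split.
- exact: near_eq_derivable dq.
- exact: near_eq_derivable ddq.
- move=> k; rewrite -(nbhs_singleton q12) -(nbhs_singleton dq12).
  apply: near_eq_is_derive (EL k).
  by apply: filterS2 q12 dq12 => s -> ->.
Qed.

Lemma derivable_change (T : set 'rV[R]_n) (phi : 'rV[R]_n -> 'rV[R]_n)
    (q : R -> 'rV[R]_n) (t : R) :
  open T -> Ck 2 T phi -> (\forall s \near t, T (q s) /\ derivable q s 1) ->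
  derivable (derive1 q) t 1 ->
  (\forall s \near t, derivable (phi \o q) s 1) /\
  derivable (derive1 (phi \o q)) t 1.
Proof.
move=> oT [dphi Dphi] qT ddq.
have Dq (s : R) : T (q s) /\ derivable q s 1 ->
    is_derive s 1 (phi \o q) ('D_(derive1 q s) phi (q s)).
  move=> [Ts dqs]; apply: is_derive_curve; first exact: dphi.
  exact: is_derive_derive1.
split; first by apply: filterS qT => s /Dq[].
(* [Ck] controls ['D_v phi] for fixed [v], while the velocity moves; hence the expansion in the
   basis. *)
apply: (near_eq_derivable (f := fun s => \sum_k (derive1 q s) 0 k *: 'D_(delta_mx 0 k) phi (q s))).
  apply: filterS qT => s Hs; rewrite -derive_basis; last by apply: dphi; case: Hs.
  by rewrite [RHS]derive1E; have [_ ->] := Dq s Hs.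
have [Tt dqt] := nbhs_singleton qT.
apply/derivable_mxP => i j; rewrite ord1.
have -> : (fun s => (\sum_k (derive1 q s) 0 k *: 'D_(delta_mx 0 k) phi (q s)) 0 j) =
    (fun s => \sum_k (derive1 q s) 0 k * ('D_(delta_mx 0 k) phi (q s)) 0 j).
  by apply/funext => s; rewrite summxE; apply: eq_bigr => k _; rewrite mxE.
have Dw := is_derive_derive1 ddq; have Dqt := is_derive_derive1 dqt.
have Dk k : is_derive t 1 ('D_(delta_mx 0 k) phi \o q)
    ('D_(derive1 q t) ('D_(delta_mx 0 k) phi) (q t)).
  by apply: is_derive_curve => //; have [H _] := Dphi (delta_mx 0 k); exact: H.
by have [] := is_derive_sumf (fun k =>
  is_deriveMf (is_derive_entry 0 k Dw) (is_derive_entry 0 j (Dk k))).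
Qed.

(* Both sides of the Euler-Lagrange equations transform by the differential of
   the coordinate change, up to second derivatives of [psi] that cancel by
   Schwarz's theorem. *)
Lemma EL_change (T : set 'rV[R]_n) (psi : 'rV[R]_n -> 'rV[R]_n)
    (L' : 'rV[R]_n * 'rV[R]_n -> R) (p : R -> 'rV[R]_n) (t : R) :
  open T -> Ck 2 T psi -> (forall y, T y -> A (psi y)) ->
  (forall y w, T y -> L' (y, w) = Lloc (psi y, 'D_w psi y)) ->
  (\forall s \near t, T (p s) /\ derivable p s 1) -> derivable (derive1 p) t 1 ->
  EL_at Lloc (psi \o p) t -> EL_at L' p t.
Proof.
move=> oT psiC psiA L'E pT ddp EL; have [dpsi Dpsi] := psiC.
have [Tp dp] := nbhs_singleton pT.
split=> // k; set e := delta_mx 0 k; set w := derive1 p t.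
have Dp := is_derive_derive1 dp.
have psi'E (s : R) : T (p s) /\ derivable p s 1 ->
    derive1 (psi \o p) s = 'D_(derive1 p s) psi (p s).
  move=> [Ts dps]; rewrite derive1E.
  by have [_ ->] := is_derive_curve (dpsi _ Ts) (is_derive_derive1 dps).
(* The field for [EL_pairing] is the image under [psi] of the k-th coordinate vector; contracting
   with it yields the k-th equation for [L']. *)
have DY : is_derive t 1 ('D_e psi \o p) ('D_w ('D_e psi) (p t)).
  by apply: is_derive_curve => //; have [H _] := Dpsi e; exact: H.
have := EL_pairing (psiA _ Tp) EL DY; rewrite -/(psi \o p) (psi'E t)// -/w => DP.
have -> : 'D_(e, 0) L' (p t, w) =
    bil ('D_('D_e psi (p t)) h (psi (p t))) ('D_w psi (p t)) ('D_w psi (p t)) / 2 -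
    'D_('D_e psi (p t)) u (psi (p t)) +
    bil (h (psi (p t))) ('D_w psi (p t)) ('D_w ('D_e psi) (p t)).
  suff H : is_derive (p t, w) (e, 0) L' (bil ('D_('D_e psi (p t)) h (psi (p t)))
    ('D_w psi (p t)) ('D_w psi (p t)) / 2 - 'D_('D_e psi (p t)) u (psi (p t)) +
    bil (h (psi (p t))) ('D_w psi (p t)) ('D_w ('D_e psi) (p t))) by have [_ ->] := H.
  apply: is_derive_line.
  apply: (near_eq_is_derive (f := fun r : R =>
    bil (h (psi (r *: e + p t))) ('D_w psi (r *: e + p t)) ('D_w psi (r *: e + p t)) / 2
    - u (psi (r *: e + p t)))).
    have cl : {for 0, continuous (fun r : R => r *: e + p t)}.
      apply/differentiable_continuous/derivable1_diffP.
      by have [] := is_derive_affine (p t) e 0.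
    have : \forall r \near (0 : R), T (r *: e + p t).
      by apply: cl; rewrite /= scale0r add0r; exact: (near_in oT Tp).
    apply: filterS => r Tr.
    have -> : r *: (e, 0) + (p t, w) = (r *: e + p t, r *: 0 + w)
      :> ('rV[R]_n * 'rV[R]_n)%type by [].
    by rewrite scaler0 add0r L'E.
  have Dl := is_derive_affine (p t) e 0.
  have p0 : 0 *: e + p t = p t by rewrite scale0r add0r.
  have Dpl : is_derive (0 : R) 1 (fun r : R => psi (r *: e + p t)) ('D_e psi (p t)).
    by rewrite -{2}p0; apply: is_derive_along; rewrite p0; exact: dpsi.
  have Dwl : is_derive (0 : R) 1 (fun r : R => 'D_w psi (r *: e + p t))
      ('D_w ('D_e psi) (p t)).
    rewrite -(schwarz_mx e w oT Tp psiC) -{2}p0; apply: is_derive_along; rewrite p0.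
    by have [H _] := Dpsi w; exact: H.
  have [dh _] := hC; have [du _] := uC; have Ap := psiA _ Tp.
  have Dh : is_derive (0 : R) 1 (fun r : R => h (psi (r *: e + p t)))
      ('D_('D_e psi (p t)) h (psi (p t))).
    have := @is_derive_curve _ _ _ h _ _ _ _ Dpl; rewrite p0; apply; exact: dh.
  have Du : is_derive (0 : R) 1 (fun r : R => u (psi (r *: e + p t)))
      ('D_('D_e psi (p t)) u (psi (p t))).
    have := @is_derive_curve _ _ _ u _ _ _ _ Dpl; rewrite p0; apply; exact: du.
  apply: (is_derive_eq (is_deriveB (is_deriveMc 2^-1 (is_derive_bil Dh Dwl Dwl)) Du)).
  rewrite p0.
  rewrite (bil_sym ('D_w ('D_e psi) (p t)) _ (hsym _)).
  move: (bil ('D_ _ h _) _ _) (bil (h _) _ _) ('D__ u _) => a b d; lra.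
(* What remains is the momentum: since ['D_w psi] is linear in [w], varying the velocity of [L']
   along [e] varies that of [Lloc] along ['D_e psi]. *)
apply: near_eq_is_derive DP; apply: filterS pT => s Hs; have [Ts _] := Hs.
rewrite (psi'E s Hs) [RHS]derive_line.
have -> : (fun r : R => L' (r *: (0, e) + (p s, derive1 p s))) =
    (fun r : R => Lloc (r *: (0, 'D_e psi (p s)) + (psi (p s), 'D_(derive1 p s) psi (p s)))).
  apply/funext => r.
  have -> : r *: (0, e) + (p s, derive1 p s) = (r *: 0 + p s, r *: e + derive1 p s)
    :> ('rV[R]_n * 'rV[R]_n)%type by [].
  have -> : r *: (0, 'D_e psi (p s)) + (psi (p s), 'D_(derive1 p s) psi (p s)) =
    (r *: 0 + psi (p s), r *: 'D_e psi (p s) + 'D_(derive1 p s) psi (p s))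
    :> ('rV[R]_n * 'rV[R]_n)%type by [].
  rewrite !scaler0 !add0r L'E// deriveDv ?deriveZv//; exact: dpsi.
by rewrite -derive_line; have [_ ->] := Lloc_dv (psi (p s)) ('D_(derive1 p s) psi (p s))
  ('D_e psi (p s)).
Qed.

Variable F : 'rV[R]_n -> R.
Hypothesis FC : Ck 2 A F.

Definition mgrad q : 'rV[R]_n := (\row_j 'D_(delta_mx 0 j) F q) *m hinv q.

Lemma mgradP q w : A q -> bil (h q) (mgrad q) w = 'D_w F q.
Proof.
move=> Aq; rewrite bil_row /mgrad -mulmxA hinvK// mulmx1.
have [dF _] := FC; rewrite (derive_basis w (dF _ Aq)); apply: eq_bigr => j _.
by rewrite mxE mulrC.
Qed.

Lemma differentiable_rV (V : normedModType R) m (M : V -> 'rV[R]_m) x :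
  (forall j, differentiable (fun y => M y 0 j) x) -> differentiable M x.
Proof.
move=> dM; have -> : M = \sum_j (fun y => M y 0 j *: delta_mx 0 j).
  by apply/funext => y; rewrite fct_sumE -rV_basis.
by apply: differentiable_sum => j; exact: differentiableZl.
Qed.

Lemma mgrad_diff q : A q -> differentiable mgrad q.
Proof.
move=> Aq; apply: differentiable_rV => j; rewrite /mgrad.
have -> : (fun y => ((\row_j 'D_(delta_mx 0 j) F y) *m hinv y) 0 j) =
    \sum_k (fun y => 'D_(delta_mx 0 k) F y * hinv y k j).
  by apply/funext => y; rewrite fct_sumE mxE; apply: eq_bigr => k _; rewrite mxE.
apply: differentiable_sum => k; apply: differentiableM; last exact: hinv_diff.
by have [_ DF] := FC; have [H _] := DF (delta_mx 0 k); exact: H.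
Qed.

Lemma mgrad_loclip q : A q -> loclip q mgrad.
Proof.
move=> Aq; apply: loclip_mx => i j; rewrite /mgrad; under eq_fun do rewrite mxE.
apply: (@closed_sum _ _ (loclip q)) => [c|f g|k]; [exact: loclip_cst|exact: loclipD|].
apply: loclipM; last exact: hinv_loclip.
under eq_fun do rewrite mxE; apply: (C1_loclip oA Aq).
by have [_ H] := FC; exact: H.
Qed.

(** The order of the quantifiers matters: [X0] and [r] are fixed before [e], so one ball defeats
    initial velocities of every size, in particular those arbitrarily close to rest. *)
Lemma no_trapped_motion q0 v0 (K0 : R) : A q0 -> 'D_v0 F q0 != 0 -> u q0 = 0 ->
  (forall q, A q -> 0 <= u q) ->
  (forall q, A q -> `|'D_(mgrad q) u q| <= K0 * u q) ->
  exists X0 r, 0 < r /\ forall (e : R) q, 0 < e -> q 0 = q0 -> derive1 q 0 = e *: X0 ->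
    (forall t : R, 0 <= t -> `|q0 - q t| < r /\ EL_at Lloc q t) -> False.
Proof.
move=> Aq0 Fv0 u0 u_ge0 uK0.
have [dF DF] := FC; have [dh _] := hC.
pose X0 := mgrad q0.
have X00 : X0 != 0.
  by apply: contra_neq Fv0 => X0E; rewrite -mgradP// -/X0 X0E bil0l.
pose m := bil (h q0) X0 X0.
have m0 : 0 < m by exact: hpos.
have lh : loclip q0 h by apply: loclip_mx => i j; exact: h_loclip.
have lX := mgrad_loclip Aq0.
have [Kh [r1 [Kh0 r10 hK]]] := derive_loclip lh.
have [KX [r2 [KX0 r20 XK]]] := derive_loclip lX.
have [Mh [r3 [Mh0 r30 hM]]] := loclip_bounded lh.
have [MX [r4 [MX0 r40 XM]]] := loclip_bounded lX.
have [c c0 hc] := bil_lower (hpos Aq0).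
pose N : R := n%:R * n%:R.
have N0 : 0 <= N by rewrite mulr_ge0.
have ch : {for q0, continuous h} by apply: differentiable_continuous; exact: dh.
have cF : {for q0, continuous F} by apply: differentiable_continuous; exact: dF.
(* Bounds, in units of [|w| ^+ 2], the two quadratic terms of [dy]: one from the derivative of the
   gradient along the velocity, one (halved) from that of the metric along the gradient. *)
pose C1 : R := N * Mh * KX + N * (Kh * MX) / 2.
have C10 : 0 <= C1 by rewrite addr_ge0// ?divr_ge0// !mulr_ge0.
(* [C1 * |w| ^+ 2] is at most [C1 / (c / 2)] times twice the kinetic energy, whence the 2; [|K0|]
   handles the potential energy, and 1 makes [C] positive. *)
pose C : R := 2 * (C1 / (c / 2)) + `|K0| + 1.
have C0 : 0 < C by rewrite ltr_wpDl// addr_ge0// mulr_ge0// divr_ge0// divr_ge0// ltW.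
(* If [h] varies by less than this, the metric keeps half of its coercivity constant [c]. The next
   bound, [m / (2 * C)], is the allowed variation of [F], equal to the growth forced by time [T]. *)
have e1 : 0 < c / 2 / (N + 1) by rewrite !divr_gt0// ltr_wpDl.
have e2 : 0 < m / (2 * C) by rewrite divr_gt0// mulr_gt0.
have [r5 r50 rP] := nbhs_dist3 (near_in oA Aq0) (near_continuous ch e1)
  (near_continuous cF e2).
pose r := Num.min r5 (Num.min (Num.min r1 r2) (Num.min r3 r4)).
exists X0, r; split; first by rewrite !lt_min r10 r20 r30 r40 r50.
move=> e q ep q0E q'0 qP.
set w := derive1 q in q'0 *.
have qr t : 0 <= t -> [/\ `|q0 - q t| < r5, `|q0 - q t| < r1, `|q0 - q t| < r2,
    `|q0 - q t| < r3 & `|q0 - q t| < r4].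
  by move=> /qP[+ _]; rewrite !lt_min => /andP[-> /andP[/andP[-> ->] /andP[-> ->]]].
have qA t : 0 <= t -> A (q t) by move=> /qr[+ _ _ _ _] => /rP[].
have qEL t : 0 <= t -> EL_at Lloc q t by move=> /qP[].
have qD (t : R) : 0 <= t -> is_derive t 1 q (w t).
  by move=> /qEL[/is_derive_derive1].
(* The metric turns the pairing of the velocity with the gradient into the derivative of [F \o q],
   while [EL_pairing] differentiates this pairing. *)
pose y t := bil (h (q t)) (w t) (mgrad (q t)).
pose dy t := bil ('D_(mgrad (q t)) h (q t)) (w t) (w t) / 2 - 'D_(mgrad (q t)) u (q t)
     + bil (h (q t)) (w t) ('D_(w t) mgrad (q t)).
have yD (t : R) : 0 <= t -> is_derive t 1 y (dy t).
  move=> t0; apply: (EL_pairing (qA t t0) (qEL t t0)).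
  by apply: is_derive_curve; [apply: mgrad_diff; exact: qA|exact: qD].
have FD (t : R) : 0 <= t -> is_derive t 1 (F \o q) (y t).
  move=> t0; rewrite /y (bil_sym _ _ (hsym (q t))) mgradP; last exact: qA.
  by apply: is_derive_curve; [apply: dF; exact: qA|exact: qD].
have E0 t : 0 <= t -> energy q t = e ^+ 2 * m / 2.
  rewrite le_eqVlt => /predU1P[<-|t0].
    by rewrite /energy q0E -/w q'0 bilZl bilZr u0 addr0 mulrA -expr2.
  have [s st /eqP] := MVT_derivable t0 (fun s (s0t : 0 <= s <= t) =>
    energy_derive (qA s (andP s0t).1) (qEL s (andP s0t).1)).
  rewrite mulr0 subr_eq0 => /eqP ->.
  by rewrite /energy q0E -/w q'0 bilZl bilZr u0 addr0 mulrA -expr2.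
have lower t : 0 <= t -> c / 2 * `|w t| ^+ 2 <= bil (h (q t)) (w t) (w t).
  move=> t0; have [/rP[_ + _] _ _ _ _] := qr t t0; rewrite distrC => hq.
  have := hc (w t); have := bil_bound2 (h (q t) - h q0) (w t).
  rewrite bilBm -/N ler_norml => /andP[+ _].
  have : N * `|h (q t) - h q0| * `|w t| ^+ 2 <= c / 2 * `|w t| ^+ 2.
    rewrite ler_wpM2r ?exprn_ge0// (@le_trans _ _ ((N + 1) * `|h (q t) - h q0|))//.
      by rewrite ler_wpM2r// lerDl.
    by rewrite mulrC -ler_pdivlMr ?ltr_wpDl// ltW.
  lra.
have dyC t : 0 <= t -> `|dy t| <= C * (e ^+ 2 * m / 2).
  move=> t0; rewrite -(E0 t t0).
  have [_ q1 q2 q3 q4] := qr t t0; have Aq := qA t t0.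
  have Xd := mgrad_diff Aq; have hd := dh _ Aq.
  have B1 : `|bil ('D_(mgrad (q t)) h (q t)) (w t) (w t)| <= N * (Kh * MX) * `|w t| ^+ 2.
    rewrite (le_trans (bil_bound2 _ _))// ler_wpM2r ?exprn_ge0//.
    rewrite ler_wpM2l// (le_trans (hK _ _ q1 hd))// ler_wpM2l//.
    exact: XM.
  have B2 : `|bil (h (q t)) (w t) ('D_(w t) mgrad (q t))| <= N * Mh * KX * `|w t| ^+ 2.
    rewrite (le_trans (bil_bound _ _ _))// -/N.
    apply: (@le_trans _ _ (N * Mh * `|w t| * (KX * `|w t|))).
      apply: ler_pM => //; [by rewrite !mulr_ge0| |exact: XK].
      by rewrite ler_wpM2r// ler_wpM2l//; exact: hM.
    have -> // : N * Mh * `|w t| * (KX * `|w t|) = N * Mh * KX * `|w t| ^+ 2 by ring.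
  have B3 : `|'D_(mgrad (q t)) u (q t)| <= `|K0| * u (q t).
    by rewrite (le_trans (uK0 _ Aq))// ler_wpM2r ?u_ge0// ler_norm.
  have B4 := lower t t0; have u_t := u_ge0 _ Aq.
  have B5 : C1 * `|w t| ^+ 2 <= C1 / (c / 2) * bil (h (q t)) (w t) (w t).
    by rewrite -mulrA ler_wpM2l// mulrC ler_pdivlMr ?divr_gt0// mulrC.
  rewrite /energy -/w; move: B1 B2 B3 B4 B5; rewrite /dy /C.
  set b := bil (h (q t)) (w t) (w t); set W := `|w t| ^+ 2.
  set b1 := bil ('D_ _ h _) _ _; set b2 := bil _ _ ('D_ _ _ _); set d3 := 'D_ _ u _.
  move=> B1 B2 B3 B4 B5.
  have W0 : 0 <= W by exact: exprn_ge0.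
  have b0 : 0 <= b by rewrite (le_trans _ B4)// mulr_ge0// divr_ge0// ltW.
  have k0 : 0 <= C1 / (c / 2) by rewrite !divr_ge0// ltW.
  rewrite (le_trans (ler_normD _ _))//.
  have Bn : `|b1 / 2 - d3| <= `|b1| / 2 + `|d3|.
    by rewrite (le_trans (ler_normB _ _))// normrM (ger0_norm (_ : 0 <= 2^-1)).
  have ku := mulr_ge0 k0 u_t; have Kb := mulr_ge0 (normr_ge0 K0) b0.
  have C1W : C1 * W = N * Mh * KX * W + N * (Kh * MX) * W / 2 by rewrite /C1; ring.
  clearbody b W b1 b2 d3.
  move: C1W B5 B1 B2 B3 Bn ku Kb.
  move: (C1 / (c / 2)) k0 (C1 * W) (N * Mh * KX * W) (N * (Kh * MX) * W).
  move: `|b1| `|b2| `|d3| `|b1 / 2 - d3| `|K0| (u (q t)) u_t.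
  move=> z1 z2 z3 z4 z5 z6 u_t k k0 y1 y2 y3.
  lra.
have y0 : y 0 = e * m by rewrite /y q0E q'0 bilZl.
(* By this time [y] can have lost at most [T * C * e ^+ 2 * m / 2 = e * m / 2], half of its initial
   value. *)
pose T := (C * e)^-1.
have T0 : 0 < T by rewrite invr_gt0 mulr_gt0.
have yT t : 0 <= t <= T -> e * m / 2 <= y t.
  move=> /andP[t0 tT]; rewrite le_eqVlt in t0; case/predU1P: t0 => [<-|t0].
    by rewrite y0; have := mulr_gt0 ep m0; lra.
  have [s /andP[s0 st] Es] := MVT_derivable t0 (fun s (s0t : 0 <= s <= t) => yD s (andP s0t).1).
  have : `|t * dy s| <= T * (C * (e ^+ 2 * m / 2)).
    by rewrite normrM ger0_norm ?(ltW t0)// ler_pM// ?(ltW t0)// dyC.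
  have -> : T * (C * (e ^+ 2 * m / 2)) = e * m / 2.
    by rewrite /T; field; rewrite !gt_eqF.
  move: Es; rewrite y0 subr0 ler_norml => <- /andP[]; lra.
have [s sT Es] := MVT_derivable T0 (fun s (s0t : 0 <= s <= T) => FD s (andP s0t).1).
have := yT s sT; rewrite -(ler_pM2l T0).
have -> : T * (e * m / 2) = m / (2 * C) by rewrite /T; field; rewrite !gt_eqF.
rewrite subr0 in Es; rewrite -Es /= q0E.
have [+ _ _ _ _] := qr T (ltW T0) => /rP[_ _].
by rewrite distrC => H1 /(le_trans)/(_ (ler_norm _)); rewrite leNgt H1.
Qed.

End LocalMechanics.

(** * Charts of the manifold and of its tangent bundle *)

Section Charts.
Context {R : realType} {n : nat} {N : smooth_manifold R n}.
Implicit Types (c : chart R n N).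

Lemma diff_diff (U V W : normedModType R) (f : U -> V) (g : V -> W) x y w :
  y = f x -> differentiable f x -> differentiable g y ->
  'd g y ('d f x w) = 'D_w (g \o f) x.
Proof.
move=> -> df dg; have dgf : differentiable (g \o f) x by exact: differentiable_comp.
rewrite (deriveE w dgf) (diff_comp df dg). reflexivity.
Qed.

Lemma cimg_dom c q : (c @` cdom c) q -> cdom c (cinv c q) /\ c (cinv c q) = q.
Proof. by move=> [x xc <-]; rewrite (cfunK (mem_set xc)). Qed.

Lemma cimg_sub c (B : set N) q : (c @` (cdom c `&` B)) q -> (c @` cdom c) q /\ B (cinv c q).
Proof.
by move=> [x [xc xB] <-]; rewrite (cfunK (mem_set xc)); split=> //; exists x.
Qed.

Lemma cimg_subP c (B : set N) q : (c @` cdom c) q -> B (cinv c q) -> (c @` (cdom c `&` B)) q.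
Proof. by move=> /cimg_dom[qc E] qB; exists (cinv c q). Qed.

Lemma open_cimg c (B : set N) : open B -> open (c @` (cdom c `&` B)).
Proof.
move=> oB; rewrite openE => q /cimg_sub[qc qB].
have nq := near_in (@cimg_open _ _ _ c) qc.
have nB : \forall y \near q, B (cinv c y).
  by apply: (cinv_continuous (mem_set qc)); exact: open_nbhs_nbhs.
by apply: filterS2 nq nB => y; exact: cimg_subP.
Qed.

Lemma transition_Ck c c' k : atlas c -> atlas c' ->
  Ck k (c @` (cdom c `&` cdom c')) (c' \o cinv c).
Proof. by move=> ac ac'; exact: atlas_smooth. Qed.

Lemma transition_diff c c' q : atlas c -> atlas c' -> (c @` (cdom c `&` cdom c')) q ->
  differentiable (c' \o cinv c) q.
Proof. by move=> ac ac' qcc'; have [H _] := transition_Ck 1 ac ac'; exact: H. Qed.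

Lemma transition_fun c c' (W : normedModType R) (F : N -> W) q w :
  atlas c -> atlas c' -> (c @` (cdom c `&` cdom c')) q ->
  differentiable (F \o cinv c') (c' (cinv c q)) ->
  'd (F \o cinv c') (c' (cinv c q)) ('d (c' \o cinv c) q w) = 'D_w (F \o cinv c) q.
Proof.
move=> ac ac' qcc' dF; have dt := transition_diff ac ac' qcc'.
rewrite (diff_diff w (erefl ((c' \o cinv c) q)) dt dF).
apply: near_eq_derive; apply: filterS (near_in (open_cimg (@cdom_open _ _ _ c')) qcc') => y.
by move=> /cimg_sub[_ yc']; rewrite /= (cfunK (mem_set yc')).
Qed.

Lemma transition_id c q w : (c @` cdom c) q -> 'D_w (c \o cinv c) q = w.
Proof.
move=> qc; have -> : 'D_w (c \o cinv c) q = 'D_w id q.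
  apply: near_eq_derive; apply: filterS (near_in (@cimg_open _ _ _ c) qc) => y.
  by move=> /cimg_dom[_].
exact: derive_id.
Qed.

Lemma transition_inv c c' q : (c @` (cdom c `&` cdom c')) q ->
  (c' @` (cdom c' `&` cdom c)) (c' (cinv c q)).
Proof. by move=> /cimg_sub[/cimg_dom[qc _] qc']; exists (cinv c q). Qed.

(** Both sides are components in the reference chart at the common base point, so this is the chain
    rule through [c']. *)
Lemma tchart_inv_change c c' q w : atlas c -> atlas c' ->
  (c @` (cdom c `&` cdom c')) q ->
  tchart_inv c (q, w) = tchart_inv c' (c' (cinv c q), 'D_w (c' \o cinv c) q).
Proof.
move=> ac ac' qcc'; rewrite /tchart_inv /=.
have [qc qc'] := cimg_sub qcc'; rewrite (cfunK (mem_set qc')).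
set x := cinv c q; set a := chart_at x.
have aa : atlas a by exact: chart_at_atlas.
have xa : cdom a x by exact: chart_at_dom.
have qca : (c @` (cdom c `&` cdom a)) q by exact: cimg_subP.
have dt := transition_diff ac aa qca.
have dt' : differentiable (a \o cinv c') (c' x).
  by apply: transition_diff => //; exists x => //; split.
have E := transition_fun w ac ac' qcc' dt'.
congr Tangent; rewrite (deriveE w (transition_diff ac ac' qcc')).
exact (etrans (esym (deriveE w dt)) (esym E)).
Qed.

Lemma tchart_inv0 c q : tchart_inv c (q, 0) = Tangent (cinv c q) 0.
Proof. by rewrite /tchart_inv /= linear0. Qed.

(** In [lift] the reference chart is frozen at time [t] while the curve moves, so the chain rule
    with a fixed transition map applies; continuity keeps the curve in the domain of [c] near
    [t]. *)
Lemma lift_chart c (x : R -> N) (t : R) : atlas c -> {for t, continuous x} ->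
  cdom c (x t) -> derivable (c \o x) t 1 ->
  Defs.lift x t = tchart_inv c (c (x t), derive1 (c \o x) t).
Proof.
move=> ac cx xc dq; rewrite /Defs.lift /tchart_inv /= (cfunK (mem_set xc)); congr Tangent.
set a := chart_at (x t).
have qca : (c @` (cdom c `&` cdom a)) (c (x t)).
  by exists (x t) => //; split=> //; exact: chart_at_dom.
have dt := transition_diff ac (chart_at_atlas (x t)) qca.
rewrite -(deriveE _ dt) derive1E.
have [_ <-] := is_derive_curve (q := c \o x) dt (is_derive_derive1 dq).
apply: near_eq_derive.
have : \forall s \near t, cdom c (x s).
  by apply: cx; exact: open_nbhs_nbhs (conj (@cdom_open _ _ _ c) xc).
by apply: filterS => s sc /=; rewrite (cfunK (mem_set sc)).
Qed.

End Charts.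

(** * The metric, the Lagrangian and the gradient read in a chart *)

Section LocalRepresentation.
Context {R : realType} {n : nat} {N : smooth_manifold R n}.
Context (Q : TN N -> R) (U : N -> R) (rho : forall x : N, {dot 'rV[R]_n for idfun}).
Hypotheses (QC2 : Ck_TN 2 Q) (UC2 : Ck_on 2 setT U).
Hypothesis rhoQ : forall (x : N) (v : 'rV[R]_n), Q (Tangent x v) = rho x v v / 2.
Implicit Types (c : chart R n N).

Lemma differentiable_mx (V : normedModType R) m l (M : V -> 'M[R]_(m, l)) x :
  (forall i j, differentiable (fun y => M y i j) x) -> differentiable M x.
Proof.
move=> dM; have -> : M = \sum_i \sum_j (fun y => M y i j *: delta_mx i j).
  apply/funext => y; rewrite fct_sumE {1}(matrix_sum_delta (M y)).
  by apply: eq_bigr => i _; rewrite fct_sumE.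
by apply: differentiable_sum => i; apply: differentiable_sum => j; exact: differentiableZl.
Qed.

Lemma Ck_mx (V : normedModType R) m l k (A : set V) (M : V -> 'M[R]_(m, l)) : open A ->
  (forall i j, Ck k A (fun y => M y i j)) -> Ck k A M.
Proof.
move=> oA; elim: k M => [|k IH] M CM.
  move=> x Ax; apply/cvgrPdist_le => e e0.
  have H (ij : 'I_m * 'I_l) : \forall y \near x, `|M x ij.1 ij.2 - M y ij.1 ij.2| < e.
    exact: near_continuous (CM ij.1 ij.2 x Ax) e0.
  have {}H : \forall y \near x, forall ij : 'I_m * 'I_l,
      `|M x ij.1 ij.2 - M y ij.1 ij.2| < e by exact: filter_forall.
  near=> y; apply: mx_norm_le => [|i j]; first exact: ltW.
  rewrite !mxE ltW//.
  have : forall ij : 'I_m * 'I_l, `|M x ij.1 ij.2 - M y ij.1 ij.2| < e by near: y.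
  by move=> /(_ (i, j)).
have dM x : A x -> differentiable M x.
  by move=> Ax; apply: differentiable_mx => i j; have [H _] := CM i j; exact: H.
split=> // v; apply: IH => i j; have [_ H] := CM i j.
apply: (Ck_eq oA _ (H v)) => x Ax.
by rewrite (derive_entry v i j (dM x Ax)).
Unshelve. all: by end_near. Qed.

Definition chart_diff c q : 'rV[R]_n -> 'rV[R]_n := 'd (chart_at (cinv c q) \o cinv c) q.

(** The Gram matrix of the metric in the coordinates of [c]: [rho] acts on components in the
    reference chart, to which [chart_diff] converts. *)
Definition hmat c q : 'M[R]_n :=
  \matrix_(i, j) rho (cinv c q) (chart_diff c q (delta_mx 0 i)) (chart_diff c q (delta_mx 0 j)).

Lemma rho_sym x v w : rho x v w = rho x w v.
Proof. by rewrite (hermC (rho x) v w) expr0 mul1r. Qed.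

Lemma rhoZl x a v w : rho x (a *: v) w = a * rho x v w.
Proof. by rewrite linearZl_LR. Qed.

Lemma rhoZr x a v w : rho x v (a *: w) = a * rho x v w.
Proof. by rewrite linearZr_LR. Qed.

Lemma rho_suml x (a : 'I_n -> R) (v : 'I_n -> 'rV[R]_n) w :
  rho x (\sum_i a i *: v i) w = \sum_i a i * rho x (v i) w.
Proof. by rewrite linear_sumlz; apply: eq_bigr => i _; exact: rhoZl. Qed.

Lemma rho_sumr x (a : 'I_n -> R) (v : 'I_n -> 'rV[R]_n) w :
  rho x w (\sum_i a i *: v i) = \sum_i a i * rho x w (v i).
Proof. by rewrite linear_sumr; apply: eq_bigr => i _; exact: rhoZr. Qed.

Lemma rhoDl x u v w : rho x (u + v) w = rho x u w + rho x v w.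
Proof. by rewrite linearDl. Qed.

Lemma rhoDr x u v w : rho x u (v + w) = rho x u v + rho x u w.
Proof. by rewrite linearDr. Qed.

Lemma rho_polar x v w :
  rho x v w = rho x (v + w) (v + w) / 2 - rho x v v / 2 - rho x w w / 2.
Proof. by rewrite rhoDl !rhoDr (rho_sym x w v); lra. Qed.

Lemma chart_diffD c q v w : chart_diff c q (v + w) = chart_diff c q v + chart_diff c q w.
Proof. by rewrite /chart_diff linearD. Qed.

Lemma bil_hmat c q v w :
  bil (hmat c q) v w = rho (cinv c q) (chart_diff c q v) (chart_diff c q w).
Proof.
have dE w' : chart_diff c q w' = \sum_i w' 0 i *: chart_diff c q (delta_mx 0 i).
  rewrite /chart_diff {1}(rV_basis w') linear_sum.
  by apply: eq_bigr => i _; rewrite linearZ.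
rewrite bilE (dE v) rho_suml; apply: eq_bigr => i _.
rewrite (dE w) rho_sumr mulr_sumr; apply: eq_bigr => j _.
by rewrite mxE; ring.
Qed.

Lemma Lmech_chart c : Lmech Q U \o tchart_inv c = Lloc (hmat c) (U \o cinv c).
Proof. by apply/funext => -[q w]; rewrite /Lloc /= bil_hmat /Lmech /tchart_inv/= rhoQ. Qed.

Lemma hmat_sym c q i j : hmat c q i j = hmat c q j i.
Proof. by rewrite !mxE rho_sym. Qed.

(** [rho] is given point by point, in reference charts that may jump; regularity of its coefficients
    comes from [Q] by polarization at frozen velocities. *)
Lemma hmat_Ck c : atlas c -> Ck 2 (c @` cdom c) (hmat c).
Proof.
move=> ac; have oc := @cimg_open _ _ _ c; apply: Ck_mx => // i j.
pose Qc := Q \o tchart_inv c.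
have CQ w : Ck 2 (c @` cdom c) (fun q => Qc (q, w)) by apply: Ck_fst; exact: QC2.
have -> : (fun q => hmat c q i j) =
    (fun q => Qc (q, delta_mx 0 i + delta_mx 0 j)) - (fun q => Qc (q, delta_mx 0 i))
    - (fun q => Qc (q, delta_mx 0 j)).
  apply/funext => q; rewrite mxE.
  rewrite -[RHS]/(Qc (q, delta_mx 0 i + delta_mx 0 j) - Qc (q, delta_mx 0 i)
    - Qc (q, delta_mx 0 j)) /Qc /tchart_inv /= !rhoQ -!/(chart_diff c q _).
  by rewrite chart_diffD; exact: rho_polar.
by apply: CkB => //; apply: CkB.
Qed.

Lemma U_chart_Ck c : atlas c -> Ck 2 (c @` cdom c) (U \o cinv c).
Proof. by move=> ac; have := UC2 ac; rewrite setIT. Qed.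

Lemma chart_at_trans c q : (c @` cdom c) q ->
  (c @` (cdom c `&` cdom (chart_at (cinv c q)))) q.
Proof. by move=> qc; apply: cimg_subP => //; exact: chart_at_dom. Qed.

(** Injectivity of [chart_diff], on which the positivity of [hmat] rests; the opposite composite,
    [chart_diffKV], gives the surjectivity used for gradients. *)
Lemma chart_diffK c q w : atlas c -> (c @` cdom c) q ->
  'd (c \o cinv (chart_at (cinv c q))) (chart_at (cinv c q) (cinv c q)) (chart_diff c q w) = w.
Proof.
move=> ac qc; have aa := chart_at_atlas (cinv c q); have qca := chart_at_trans qc.
rewrite /chart_diff (transition_fun (F := c) w ac aa qca) ?transition_id//.
by apply: transition_diff => //; exact: transition_inv.
Qed.

Lemma chart_diffKV c q v : atlas c -> (c @` cdom c) q ->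
  chart_diff c q ('d (c \o cinv (chart_at (cinv c q)))
    (chart_at (cinv c q) (cinv c q)) v) = v.
Proof.
move=> ac qc; set a := chart_at (cinv c q); have aa : atlas a := chart_at_atlas _.
have qca := chart_at_trans qc; have qac := transition_inv qca.
have [xc xE] := cimg_dom qc.
have yE : q = (c \o cinv a) (a (cinv c q)).
  by rewrite /= (cfunK (mem_set (chart_at_dom (cinv c q)))) xE.
rewrite /chart_diff (diff_diff v yE (transition_diff aa ac qac) (transition_diff ac aa qca)).
have -> : 'D_v ((a \o cinv c) \o (c \o cinv a)) (a (cinv c q)) = 'D_v id (a (cinv c q)).
  apply: near_eq_derive.
  apply: filterS (near_in (open_cimg (@cdom_open _ _ _ c)) qac) => y /cimg_sub[ya yc].
  by rewrite /= (cfunK (mem_set yc)); have [_] := cimg_dom ya.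
exact: derive_id.
Qed.

Lemma hmat_pos c q w : atlas c -> (c @` cdom c) q -> w != 0 -> 0 < bil (hmat c q) w w.
Proof.
move=> ac qc w0; rewrite bil_hmat; apply: neq0_dnorm_gt0.
by apply: contra_neq w0 => w0; rewrite -(chart_diffK w ac qc) w0 linear0.
Qed.

(** The witness [g] ensures that [xget] does not fall back on its default 0; uniqueness follows from
    positive definiteness, tested on the difference. *)
Lemma grad_eq (F : N -> R) x g : (forall v, rho x g v = dmfd F x v) -> grad rho F x = g.
Proof.
move=> gF; have gG : [set g | forall v, rho x g v = dmfd F x v] (grad rho F x).
  by apply: (xgetI 0 (x := g)).
apply/eqP; rewrite -subr_eq0; set d := grad rho F x - g; apply/negPn/negP => d0.
have : 0 < rho x d d by exact: neq0_dnorm_gt0.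
have -> : rho x d d = rho x (grad rho F x) d - rho x g d.
  by rewrite {1}/d -[- g]scaleN1r rhoDl rhoZl mulN1r.
by rewrite gG gF subrr ltxx.
Qed.

Lemma dmfd_chart (F : N -> R) (B : set N) c q w : open B -> Ck_on 1 B F ->
  atlas c -> (c @` (cdom c `&` B)) q ->
  dmfd F (cinv c q) (chart_diff c q w) = 'D_w (F \o cinv c) q.
Proof.
move=> oB FC ac /cimg_sub[qc qB]; have aa := chart_at_atlas (cinv c q).
apply: transition_fun => //; first exact: chart_at_trans.
have [H _] := FC _ aa; apply: H; exists (cinv c q) => //.
by split=> //; exact: chart_at_dom.
Qed.

(** Carries the hypothesis on [dU] into a chart. The image of [mgrad] under [chart_diff] has the
    defining property of the gradient, every tangent vector being itself such an image. *)
Lemma hmat_grad c (F : N -> R) (B : set N) q : open B -> Ck_on 2 B F ->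
  atlas c -> (c @` (cdom c `&` B)) q ->
  'D_(mgrad (hmat c) (F \o cinv c) q) (U \o cinv c) q =
  dmfd U (cinv c q) (grad rho F (cinv c q)).
Proof.
move=> oB FC ac qB; have [qc _] := cimg_sub qB.
have FC1 : Ck_on 1 B F by move=> c' ac'; exact: CkS (FC c' ac').
have UC1 : Ck_on 1 setT U by move=> c' ac'; exact: CkS (UC2 ac').
have -> : grad rho F (cinv c q) = chart_diff c q (mgrad (hmat c) (F \o cinv c) q).
  apply: grad_eq => v; rewrite -{1}(chart_diffKV v ac qc) -bil_hmat.
  rewrite (mgradP (A := c @` (cdom c `&` B)))//.
  - rewrite -(dmfd_chart _ oB FC1 ac qB); congr dmfd; exact: chart_diffKV.
  - by move=> y /cimg_sub[yc _] w; exact: hmat_pos.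
  - exact: FC.
rewrite (dmfd_chart _ openT UC1 ac)//; exact: cimg_subP.
Qed.

End LocalRepresentation.

(** * Maximal solutions *)

Section MaximalSolutions.
Context {R : realType} {n : nat} {N : smooth_manifold R n} (L : TN N -> R).

Definition EL_on_charts (x : R -> N) (t : R) := {for t, continuous x} /\
  forall c, atlas c -> cdom c (x t) -> EL_at (L \o tchart_inv c) (c \o x) t.

Lemma EL_solutionP a b x : EL_solution L a b x <->
  (a < 0%:E < b)%E /\ forall t : R, (a < t%:E < b)%E -> EL_on_charts x t.
Proof. by []. Qed.

Lemma EL_on_charts_near x y (t : R) : (\forall s \near t, x s = y s) ->
  EL_on_charts x t -> EL_on_charts y t.
Proof.
move=> xy [cx EL]; split=> [|c ac yc].
  have cy : y @ t --> x t by apply: cvg_trans cx; exact: near_eq_cvg.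
  by rewrite (nbhs_singleton xy) in cy.
have xc : cdom c (x t) by rewrite (nbhs_singleton xy).
apply: EL_at_near (EL c ac xc).
by apply: filterS xy => s /= ->.
Qed.

Lemma near_itv (a b : \bar R) (t : R) : (a < t%:E < b)%E ->
  \forall s \near t, (a < s%:E < b)%E.
Proof.
move=> /andP[at_ tb].
have na : \forall s \near t, (a < s%:E)%E.
  case: a at_ => [r||] //; last by move=> _; near=> s; exact: ltNyr.
  by rewrite lte_fin => rt; near=> s; rewrite lte_fin; near: s; exact: lt_nbhsr.
have nb : \forall s \near t, (s%:E < b)%E.
  case: b tb => [r||] //; last by move=> _; near=> s; exact: ltry.
  by rewrite lte_fin => rt; near=> s; rewrite lte_fin; near: s; exact: lt_nbhsl.
by apply: filterS2 na nb => s -> ->.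
Unshelve. all: by end_near. Qed.

Let curve := ((\bar R * \bar R) * (R -> N))%type.
Let dom (s : curve) (t : R) : Prop := (s.1.1 < t%:E < s.1.2)%E.
Let extends (s s' : curve) := [/\ (s'.1.1 <= s.1.1)%E, (s.1.2 <= s'.1.2)%E &
  forall t, dom s t -> s'.2 t = s.2 t].

Let extends_dom s s' t : extends s s' -> dom s t -> dom s' t.
Proof.
move=> [aa bb _] /andP[at_ tb]; rewrite /dom.
by rewrite (le_lt_trans aa at_) (lt_le_trans tb bb).
Qed.

Let extends_trans s1 s2 s3 : extends s1 s2 -> extends s2 s3 -> extends s1 s3.
Proof.
move=> e12 [a23 b23 x23]; have [a12 b12 x12] := e12; split.
- exact: le_trans a23 a12.
- exact: le_trans b12 b23.
- by move=> t st; rewrite x23 ?x12//; exact: extends_dom st.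
Qed.

(** The union of a chain of solutions. A time between the infimum of the left ends and the supremum
    of the right ends is covered, since two members reaching past it on either side are comparable;
    comparability also makes the values agree. *)
Let chain_bound (s0 : curve) (S : set curve) :
  S s0 -> (forall s, S s -> EL_solution L s.1.1 s.1.2 s.2) ->
  (forall s s', S s -> S s' -> extends s s' \/ extends s' s) ->
  exists2 m : curve, EL_solution L m.1.1 m.1.2 m.2 & forall s, S s -> extends s m.
Proof.
move=> S0 Ssol Stot.
pose a := ereal_inf [set s.1.1 | s in S].
pose b := ereal_sup [set s.1.2 | s in S].
have cover (t : R) : (a < t%:E < b)%E -> exists2 s, S s & dom s t.
  move=> /andP[/ereal_inf_lt[_ [s1 S1 <-] s1t] /ereal_sup_gt[_ [s2 S2 <-] s2t]].
  have [[e1 e2 _]|[e1 e2 _]] := Stot s1 s2 S1 S2.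
    by exists s2 => //; rewrite /dom s2t (le_lt_trans e1 s1t).
  by exists s1 => //; rewrite /dom s1t (lt_le_trans s2t e2).
have /choice[y yP] : forall t, exists y, forall s, S s -> dom s t -> y = s.2 t.
  move=> t; have [[s [Ss st]]|none] := pselect (exists s, S s /\ dom s t).
    (* At times covered by no member of the chain, the next branch takes the value of [s0] as a
       default. *)
    exists (s.2 t) => s' Ss' s't.
    by have [[_ _ E]|[_ _ E]] := Stot s s' Ss Ss'; rewrite E.
  by exists (s0.2 t) => s Ss st; exfalso; apply: none; exists s.
exists ((a, b), y) => [|s Ss]; last first.
  split=> [||t st]; last exact: yP.
    by apply: ereal_inf_lbound; exists s.
  by apply: ereal_sup_ubound; exists s.
apply/EL_solutionP; split=> /=.
  have [/andP[a0 b0] _] := (EL_solutionP _ _ _).1 (Ssol s0 S0).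
  apply/andP; split.
    by apply: le_lt_trans a0; apply: ereal_inf_lbound; exists s0.
  by apply: lt_le_trans b0 _; apply: ereal_sup_ubound; exists s0.
move=> t /cover[s Ss st].
have [_ H] := (EL_solutionP _ _ _).1 (Ssol s Ss).
apply: EL_on_charts_near (H t st).
by apply: filterS (near_itv st) => r sr; rewrite (yP r s).
Qed.

Lemma maximal_extension a b x : EL_solution L a b x ->
  exists a' b' y, maximal_EL_solution L a' b' y /\
    forall t : R, (a < t%:E < b)%E -> y t = x t.
Proof.
move=> xsol; pose s0 : curve := ((a, b), x).
pose T := {s : curve | EL_solution L s.1.1 s.1.2 s.2 /\ extends s0 s}.
pose t0 : T := exist _ s0 (conj xsol (And3 (lexx _) (lexx _) (fun t _ => erefl))).
pose le (s s' : T) : bool := `[< extends (sval s) (sval s') >].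
(* Only a preorder: curves are compared on their intervals and may differ outside. Maximality thus
   returns a mutual extension, which is enough to identify the endpoints. *)
have [| | |m mP] := @ZL_preorder T t0 le.
- by move=> s; apply/asboolP; split.
- by move=> s r t /asboolP e1 /asboolP e2; apply/asboolP; exact: extends_trans e1 e2.
- move=> C Ctot.
  have [[c Cc]|empty] := pselect (exists c, C c); last first.
    by exists t0 => s Cs; exfalso; apply: empty; exists s.
  have [|||m msol mP] := @chain_bound (sval c) [set sval s | s in C].
  + by exists c.
  + by move=> _ [s _ <-]; case: (svalP s).
  + by move=> _ _ [s Cs <-] [s' Cs' <-]; have [/asboolP|/asboolP] := Ctot s s' Cs Cs';
      [left|right].
  have cm : extends (sval c) m by apply: mP; exists c.
  have [_ e0c] := svalP c.
  exists (exist _ m (conj msol (extends_trans e0c cm))) => s Cs.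
  by apply/asboolP; apply: mP; exists s.
case: m mP => -[[a' b'] y] /= [ysol e0y] mP.
exists a', b', y; split; last by have [_ _] := e0y.
split=> // a2 b2 z zsol aa bb zy.
have eyz : extends ((a', b'), y) ((a2, b2), z) by split.
have /asboolP[/= a2a b2b _] := mP (exist _ ((a2, b2), z) (conj zsol (extends_trans e0y eyz)))
  (asboolT eyz).
by split; apply/eqP; rewrite eq_le; apply/andP.
Qed.

End MaximalSolutions.

(** * The equilibrium, and motions with prescribed initial data *)

Section Instability.
Context {R : realType} {n : nat} {N : smooth_manifold R n}.
Context (Q : TN N -> R) (U : N -> R) (rho : forall x : N, {dot 'rV[R]_n for idfun}).
Hypotheses (QC2 : Ck_TN 2 Q) (UC2 : Ck_on 2 setT U) (U_ge0 : forall x, 0 <= U x).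
Hypothesis rhoQ : forall (x : N) (v : 'rV[R]_n), Q (Tangent x v) = rho x v v / 2.

Lemma derivable_continuous_at (V : normedModType R) (f : R -> V) (t : R) :
  derivable f t 1 -> {for t, continuous f}.
Proof. by move/derivable1_diffP; exact: differentiable_continuous. Qed.

Lemma derive_at_min (V : normedModType R) (F : V -> R) (A : set V) x v : open A -> A x ->
  (forall y, A y -> differentiable F y) -> (forall y, A y -> F x <= F y) -> 'D_v F x = 0.
Proof.
move=> oA Ax dF Fmin.
have cl : {for 0, continuous (fun r : R => r *: v + x)}.
  apply/differentiable_continuous/derivable1_diffP.
  by have [] := is_derive_affine x v 0.
have : \forall r \near (0 : R), A (r *: v + x).
  by apply: cl; rewrite /= scale0r add0r; exact: near_in oA Ax.
move=> /nbhs_dist[e e0 eA].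
have inA (r : R) : r \in `]- e, e[ -> A (r *: v + x).
  rewrite in_itv /= => /andP[r1 r2]; apply: eA.
  by rewrite sub0r normrN ltr_norml r1 r2.
have [|r re|||_ E] := @derive1_at_min R (fun r => F (r *: v + x)) (- e) e 0.
- by rewrite ge0_cp// ltW.
- by have [] := is_derive_along (dF _ (inA r re)).
- by rewrite in_itv /= oppr_lt0 e0.
- by move=> r re; rewrite scale0r add0r; apply: Fmin; exact: inA.
by rewrite derive_line.
Qed.

(** [U] attains its minimum 0 at [p], so its derivative vanishes there and the constant curve solves
    the equations. *)
Lemma rest_equilibrium p : U p = 0 -> equilibrium (Lmech Q U) (Tangent p 0).
Proof.
move=> Up; exists (fun=> p); last first.
  move=> t; rewrite /Defs.lift; congr Tangent.
  by rewrite -[chart_at p \o _]/(fun=> chart_at p p) derive1_cst.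
apply/EL_solutionP; split; first by rewrite ltNyr ltry.
move=> t _; split=> [|c ac pc]; first exact: cst_continuous.
set q := c \o _; have qE : q = (fun=> c p) by [].
have q'E : derive1 q = (fun=> 0) by apply/funext => s; rewrite qE derive1_cst.
have cpc : (c @` cdom c) (c p) by exists p.
have hC := hmat_Ck QC2 rhoQ ac; have uC := U_chart_Ck UC2 ac.
rewrite (Lmech_chart U rhoQ c); split.
- by rewrite qE; exact: derivable_cst.
- by rewrite q'E; exact: derivable_cst.
move=> k; rewrite q'E qE.
have [_ ->] := Lloc_dq hC uC 0 (delta_mx 0 k) cpc.
have -> : 'D_(delta_mx 0 k) (U \o cinv c) (c p) = 0.
  have [dU _] := uC;
apply: (@derive_at_min _ _ _ _ (delta_mx 0 k) (@cimg_open _ _ _ c) cpc dU) => y _ /=.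
  by rewrite (cfunK (mem_set pc)) Up.
by rewrite bil0l mul0r subr0; exact: is_derive_cst.
Qed.

Lemma local_solution c p w : atlas c -> cdom c p -> exists2 d : R, 0 < d &
  exists x : R -> N, [/\ EL_solution (Lmech Q U) (- d)%:E d%:E x, x 0 = p &
    derive1 (c \o x) 0 = w].
Proof.
move=> ac pc.
have hC := hmat_Ck QC2 rhoQ ac; have uC := U_chart_Ck UC2 ac.
have oc := @cimg_open _ _ _ c.
have cpc : (c @` cdom c) (c p) by exists p.
have [d d0 [q [q0 q'0 qEL]]] := local_existence oc hC uC (hmat_sym rho c)
  (fun y yc w => @hmat_pos _ _ _ rho c y w ac yc) w cpc.
exists d => //; pose x := cinv c \o q.
have near_d (t : R) : `|t| < d -> \forall s \near t, `|s| < d.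
  move=> td; have : (- d%:E < t%:E < d%:E)%E by rewrite !lte_fin -ltr_norml.
  by move=> /near_itv; apply: filterS => s; rewrite !lte_fin -ltr_norml.
have cxE (t : R) : `|t| < d -> \forall s \near t, q s = (c \o x) s.
  move=> /near_d; apply: filterS => s /qEL[/cimg_dom[_ E] _].
  by rewrite /x /= E.
exists x; split; last 2 first.
- by rewrite /x /= q0 (cfunK (mem_set pc)).
- have z0 : `|0 : R| < d by rewrite normr0.
  by rewrite -q'0 (nbhs_singleton (near_derive1 (cxE 0 z0))).
apply/EL_solutionP; split; first by rewrite !lte_fin oppr_lt0 d0.
move=> t; rewrite !lte_fin -ltr_norml => td.
have [qtc [dq ddq ELq]] := qEL t td.
have cq := derivable_continuous_at dq.
split=> [|c' ac' xc'].
  exact: (cvg_comp _ _ cq (cinv_continuous (mem_set qtc))).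
have qtcc' : (c @` (cdom c `&` cdom c')) (q t) by exact: cimg_subP.
have oT := open_cimg (@cdom_open _ _ _ c') : open (c @` (cdom c `&` cdom c')).
have oT' := open_cimg (@cdom_open _ _ _ c) : open (c' @` (cdom c' `&` cdom c)).
have qT : \forall s \near t, (c @` (cdom c `&` cdom c')) (q s) /\ derivable q s 1.
  have n1 : \forall s \near t, (c @` (cdom c `&` cdom c')) (q s).
    by apply: cq; exact: near_in oT qtcc'.
  by apply: filterS2 n1 (near_d t td) => s s1 /qEL[_ []].
have [dp ddp] := derivable_change oT (transition_Ck 2 ac ac') qT ddq.
(* Here [psi] goes from [c'] back to [c], where the equations are known; [derivable_change] in the
   other direction supplied the two derivatives in [c']. *)
apply: (EL_change hC uC (hmat_sym rho c) oT' (transition_Ck 2 ac' ac)).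
- by move=> y /transition_inv/cimg_sub[].
- move=> y w' yT; rewrite -(Lmech_chart U rhoQ c) /=; congr (Lmech _ _ _).
  exact: tchart_inv_change.
- by apply: filterS2 qT dp => s [+ _] => /transition_inv.
- exact: ddp.
apply: EL_at_near (And3 dq ddq ELq).
apply: filterS qT => s [/cimg_sub[/cimg_dom[_ E] sc'] _].
by rewrite /x /= (cfunK (mem_set sc')) E.
Qed.

End Instability.

Unset Implicit Arguments.
Set Strict Implicit.
Set Printing Implicit Defensive.

Theorem theorem1p1 (R : realType) (n : nat) (N : smooth_manifold R n)
    (Q : TN N -> R) (U : N -> R)
    (Qquad : forall x : N, quadratic_form (fun v => Q (Tangent x v)))
    (Qpos : forall x : N, posdef (fun v => Q (Tangent x v)))
    (QC2 : Ck_TN 2 Q)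
    (UC2 : Ck_on 2 setT U) (U_ge0 : forall x : N, 0 <= U x)
    (rho : forall x : N, {dot 'rV[R]_n for idfun})
    (rhoQ : forall (x : N) (v : 'rV[R]_n), Q (Tangent x v) = rho x v v / 2)
    (p : N) (Up : U p = 0)
    (V : set N) (pV : open_nbhs p V)
    (f : N -> R) (fC3 : Ck_on 3 V f) (freg : regular_on V f)
    (dUf : bigO_on V (fun x => dmfd U x (grad rho f x)) U) :
  equilibrium (Lmech Q U) (Tangent p 0) /\
  ~ lyapunov_stable (Lmech Q U) (Tangent p 0).
Proof.
split; first exact: (rest_equilibrium QC2 UC2 U_ge0 rhoQ Up).
move=> stable; have [oV Vp] := pV.
(* With the reference chart of [p], [dmfd f p] is by definition the differential of [f \o cinv c],
   so regularity at [p] needs no translation. *)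
pose c := chart_at p; have ac : atlas c by exact: chart_at_atlas.
have pc : cdom c p by exact: chart_at_dom.
pose A := c @` (cdom c `&` V).
have oA : open A by exact: open_cimg.
have Ap : A (c p) by exists p.
have subA : A `<=` c @` cdom c by move=> q /cimg_sub[].
have hC := Ck_sub subA (hmat_Ck QC2 rhoQ ac).
have uC := Ck_sub subA (U_chart_Ck UC2 ac).
have hpos q : A q -> forall w, w != 0 -> 0 < bil (hmat rho c q) w w.
  by move=> /subA qc w; exact: hmat_pos.
have FC : Ck 2 A (f \o cinv c) by exact: CkS (fC3 c ac).
have [v0 Fv0] := freg p Vp.
have {}Fv0 : 'D_v0 (f \o cinv c) (c p) != 0.
  by have [dF _] := FC; rewrite (deriveE v0 (dF _ Ap)).
have Up' : (U \o cinv c) (c p) = 0 by rewrite /= (cfunK (mem_set pc)).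
have [K K0 UK] := dUf.
have UK' q : A q -> `|'D_(mgrad (hmat rho c) (f \o cinv c) q) (U \o cinv c) q| <=
    K * (U \o cinv c) q.
  move=> Aq; have fC2 : Ck_on 2 V f by move=> c' ac'; exact: CkS (fC3 c' ac').
  by rewrite (hmat_grad rho UC2 oV fC2 ac Aq); apply: UK; have [] := cimg_sub Aq.
have [X0 [r [r0 trap]]] := no_trapped_motion oA hC uC (hmat_sym rho c) hpos FC Ap Fv0 Up'
  (fun q _ => U_ge0 (cinv c q)) UK'.
pose W := [set x | cdom c x /\ `|c p - c x| < r].
have oW : open W.
  rewrite openE => x [xc xr].
  have n1 : \forall y \near x, cdom c y by exact: open_nbhs_nbhs (conj (@cdom_open _ _ _ c) xc).
  have n2 : \forall y \near x, `|c x - c y| < r - `|c p - c x|.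
    have cc : {for x, continuous c} := cfun_continuous (mem_set xc).
    have e0 : 0 < r - `|c p - c x| by rewrite subr_gt0.
    exact: (cc _ (near_dist (c x) e0)).
  apply: filterS2 n1 n2 => y yc yr; split=> //.
  by rewrite -(subrKA (c x)) (le_lt_trans (ler_normD _ _))// addrC -ltrBrDr.
(* Only the position is constrained: the trap forbids staying near [p], whatever the velocity. *)
pose O := [set z : TN N | W (tbase z)].
have nO : nbhs (Tangent p 0 : TN N) O.
  apply: open_nbhs_nbhs; split; last by split=> //=; rewrite subrr normr0.
  move=> c' ac'.
  have -> : [set qw | (c' @` cdom c') qw.1 /\ O (tchart_inv c' qw)] =
      (@fst 'rV[R]_n 'rV[R]_n) @^-1` (c' @` (cdom c' `&` W)).
    apply/seteqP; split=> qw /= [].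
      by move=> qc' qW; exact: cimg_subP.
    by move=> x [xc' xW] E; split; [exists x|rewrite /O /= -E (cfunK (mem_set xc'))].
  by apply: open_comp; [move=> qw _; exact: cvg_fst|exact: open_cimg].
have [S nS stay] := stable O nO.
move: nS; rewrite nbhsE => -[B [oB Bp] BS].
(* The states with position [p] and velocity [e *: X0] tend to the equilibrium as [e] tends to 0, in
   the topology of [TN] read in [c]; some positive [e] is therefore admissible. *)
have [e e0 eB] : exists2 e : R, 0 < e & B (tchart_inv c (c p, e *: X0)).
  pose g (e : R) : 'rV[R]_n * 'rV[R]_n := (c p, e *: X0 + 0).
  have cg : {for 0, continuous g}.
    have c1 : (fun=> c p) @ (0 : R) --> c p by exact: cvg_cst.
    have c2 : {for (0 : R), continuous (fun e : R => e *: X0 + 0)}.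
      by apply: derivable_continuous_at; have [] := is_derive_affine 0 X0 0.
    exact: (cvg_pair c1 c2).
  have ng : \forall e \near (0 : R), B (tchart_inv c (g e)).
    have : \forall z \near g 0, (c @` cdom c) z.1 /\ B (tchart_inv c z).
      apply: open_nbhs_nbhs; split; first exact: oB.
      rewrite /g scale0r addr0; split; first exact: subA.
      by rewrite tchart_inv0 (cfunK (mem_set pc)).
    move=> nz; have H : \forall e \near (0 : R), (c @` cdom c) (g e).1 /\ B (tchart_inv c (g e)).
      exact: (cg _ nz).
    by apply: filterS H => e [].
  have [e1 e10 H] := nbhs_dist ng.
  exists (e1 / 2); first by rewrite divr_gt0.
  have := H (e1 / 2); rewrite /g addr0; apply.
  by rewrite sub0r normrN gtr0_norm ?divr_gt0// ltr_pdivrMr// ltr_pMr// ltr1n.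
have [d d0 [x [xsol x0 x'0]]] := local_solution QC2 UC2 rhoQ (e *: X0) ac pc.
have [a [b [y [ymax yx]]]] := maximal_extension xsol.
(* Agreement near time 0, not only at it, transfers the initial velocity to the maximal solution. *)
have yx0 : \forall s \near (0 : R), x s = y s.
  have : (- d%:E < 0%:E < d%:E)%E by rewrite !lte_fin oppr_lt0 d0.
  by move=> /near_itv; apply: filterS => s /yx.
have y0 : y 0 = p by rewrite -(nbhs_singleton yx0).
have y'0 : derive1 (c \o y) 0 = e *: X0.
  have cyx : \forall s \near (0 : R), (c \o x) s = (c \o y) s.
    by apply: filterS yx0 => s /= ->.
  by rewrite -(nbhs_singleton (near_derive1 cyx)).
have [ysol _] := ymax; have [/andP[a0 _] yEL] := (EL_solutionP _ _ _ _).1 ysol.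
have [ab0 _] := (EL_solutionP _ _ _ _).1 ysol.
have [cy0 EL0] := yEL 0 ab0.
have yc0 : cdom c (y 0) by rewrite y0.
have ly : Defs.lift y 0 = tchart_inv c (c p, e *: X0).
  by have [dq _ _] := EL0 c ac yc0; rewrite (lift_chart ac cy0 yc0 dq) y0 y'0.
have [bE ystay] : b = +oo%E /\ forall t, 0 <= t -> O (Defs.lift y t).
  by apply: (stay a b y ymax); apply: BS; rewrite ly.
have q0 : (c \o y) 0 = c p by rewrite /= y0.
refine (trap e (c \o y) e0 q0 y'0 _) => t t0.
have [yct yr] := ystay t t0; split=> //.
(* Stability gives [b = +oo], and [a < 0], so every [t >= 0] lies in the interval of the
   solution. *)
have [|_ ELt] := yEL t _; first by rewrite bE ltry andbT (lt_le_trans a0)// lee_fin.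
by rewrite -(Lmech_chart U rhoQ c); exact: ELt.
Qed.
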